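(* There is a polynomial-time $3$-approximation algorithm for each of the following three problems: Priority $k$-Supplier, Priority Knapsack Center, and Priority Matroid Center.
   Context: All metrics are finite. Priority $k$-Supplier: the input is a metric space $(X,d)$ with $X=F\uplus C$ ($C$ the clients, $F$ the facilities), a radius function $r:C\to\mathbb{R}_{>0}$ and an integer $k$; the goal is to choose $S\subseteq F$ with $|S|\le k$ minimizing $\max_{v\in C} d(v,S)/r(v)$, where $d(v,S)=\min_{s\in S}d(v,s)$. Priority Knapsack Center: the input is a metric space $(X,d)$, a radius function $r:X\to\mathbb{R}_{>0}$, a weight function $w:X\to\mathbb{R}_{\ge 0}$ and a budget $B>0$; the goal is to choose $S\subseteq X$ with $w(S)=\sum_{u\in S}w(u)\le B$ minimizing $\max_{v\in X} d(v,S)/r(v)$. Priority Matroid Center: the input is a metric space $(X,d)$, a radius function $r:X\to\mathbb{R}_{>0}$ and a matroid on ground set $X$; the goal is to choose an independent set $S$ of the matroid minimizing $\max_{v\in X} d(v,S)/r(v)$. A $\rho$-approximation algorithm outputs a feasible $S$ whose objective value is at most $\rho$ times the optimum. *)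

(* Defs.v *)
From HB Require Import structures.
From mathcomp Require Import all_boot all_order all_algebra.
From mathcomp Require Import reals constructive_ereal.
Set Implicit Arguments.
Unset Strict Implicit.
Unset Printing Implicit Defensive.
Import Order.TTheory GRing.Theory Num.Theory.
Local Open Scope ring_scope.

(** * Model of computation

    Jones' WHILE language over binary trees, with numbers as additional leaves
    and an oracle instruction. Syntax does not mention the number field, so one
    program runs over every field. Structural operations have unit cost (trees
    are shared by pointers, and no operation traverses a tree); an arithmetic
    operation is charged the sizes [sz] of its operands and of its result.
    - With [sz := unit_size] this is the real RAM (unit-cost arithmetic).
    - Over [rat] with [sz := bit_size] it is the logarithmic-cost model, which is
      polynomially equivalent to Turing machines on binary-encoded rationals. *)

Inductive val (R : Type) : Type :=
| VNil
| VNum of R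
| VPair of val R & val R.
Arguments VNil {R}.

Inductive op := Add | Sub | Mul | Div.

Inductive expr : Type :=
| EVar of nat
| ENil
| EPair of expr & expr
| EFst of expr
| ESnd of expr
| ENum of nat
| EOp of op & expr & expr
| ELe of expr & expr.

Inductive cmd : Type :=
| Skip
| Assign of nat & expr
| Query of nat & expr
| Seq of cmd & cmd
| If of expr & cmd & cmd
| While of expr & cmd.

(* [VNil] is the truth value false, everything else is true. *)
Definition truthy (R : Type) (v : val R) : bool :=
  if v is VNil then false else true.

Definition vbool (R : Type) (b : bool) : val R :=
  if b then VPair VNil VNil else VNil.

Definition vlist (R : Type) (s : seq (val R)) : val R := foldr (@VPair R) VNil s.

Definition vnums (R : Type) (s : seq R) : val R := vlist [seq VNum x | x <- s].

Fixpoint list_of (R : Type) (v : val R) : seq (val R) :=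
  if v is VPair a b then a :: list_of b else [::].

(* A subset of [T] is represented by its characteristic list along [enum T]. *)
Definition set_of (R : Type) (T : finType) (v : val R) : {set T} :=
  [set x : T | truthy (nth VNil (list_of v) (enum_rank x))].

Section Semantics.
Variables (R : realFieldType) (sz : R -> nat) (oracle : val R -> bool).

Definition store := nat -> val R.

Definition upd (st : store) (x : nat) (v : val R) : store :=
  fun y => if y == x then v else st y.

Definition num_size (v : val R) : nat := if v is VNum x then sz x else 0%N.

Fixpoint vsize (v : val R) : nat :=
  match v with
  | VNil => 1%N
  | VNum x => (sz x).+1
  | VPair a b => (vsize a + vsize b).+1
  end.

Definition op_sem (o : op) (x y : R) : R :=
  match o with Add => x + y | Sub => x - y | Mul => x * y | Div => x / y end.

(* Ill-typed operations return [VNil]. *)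
Fixpoint eval (st : store) (e : expr) : val R :=
  match e with
  | EVar x => st x
  | ENil => VNil
  | EPair a b => VPair (eval st a) (eval st b)
  | EFst a => if eval st a is VPair u _ then u else VNil
  | ESnd a => if eval st a is VPair _ u then u else VNil
  | ENum n => VNum n%:R
  | EOp o a b =>
      match eval st a, eval st b with
      | VNum x, VNum y => VNum (op_sem o x y)
      | _, _ => VNil
      end
  | ELe a b =>
      match eval st a, eval st b with
      | VNum x, VNum y => vbool R (x <= y)
      | _, _ => VNil
      end
  end.

Fixpoint ecost (st : store) (e : expr) : nat :=
  match e with
  | EVar _ | ENil => 1
  | EPair a b => (ecost st a + ecost st b).+1
  | EFst a | ESnd a => (ecost st a).+1
  | ENum _ => (num_size (eval st e)).+1
  | EOp _ a b | ELe a b =>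
      (ecost st a + ecost st b + num_size (eval st a) + num_size (eval st b)
       + num_size (eval st e)).+1
  end%N.

(* [exec c st st' t]: started in [st], [c] halts in [st'] after time [t]. *)
Inductive exec : cmd -> store -> store -> nat -> Prop :=
| exec_skip st : exec Skip st st 1
| exec_assign x e st :
    exec (Assign x e) st (upd st x (eval st e)) (ecost st e).+1
| exec_query x e st :
    exec (Query x e) st (upd st x (vbool R (oracle (eval st e))))
         (ecost st e).+1
| exec_seq c1 c2 st1 st2 st3 t1 t2 :
    exec c1 st1 st2 t1 -> exec c2 st2 st3 t2 ->
    exec (Seq c1 c2) st1 st3 (t1 + t2).+1
| exec_if e c1 c2 st st' t :
    exec (if truthy (eval st e) then c1 else c2) st st' t ->
    exec (If e c1 c2) st st' (ecost st e + t).+1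
| exec_while_stop e c st :
    ~~ truthy (eval st e) -> exec (While e c) st st (ecost st e).+1
| exec_while_step e c st1 st2 st3 t1 t2 :
    truthy (eval st1 e) -> exec c st1 st2 t1 -> exec (While e c) st2 st3 t2 ->
    exec (While e c) st1 st3 (ecost st1 e + t1 + t2).+1.

Lemma exec_det c st st1 t1 st2 t2 :
  exec c st st1 t1 -> exec c st st2 t2 -> st1 = st2 /\ t1 = t2.
Proof.
move=> H; elim: H st2 t2 => {c st st1 t1}.
- by move=> st st2 t2 H; inversion H.
- by move=> x e st st2 t2 H; inversion H.
- by move=> x e st st2 t2 H; inversion H.
- move=> c1 c2 s1 s2 s3 t1 t2 _ IH1 _ IH2 st t H; inversion H as
    [| | |? ? ? s ? ? ? K1 K2| | |]; subst.
  have [? ?] := IH1 _ _ K1; subst.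
  by have [? ?] := IH2 _ _ K2; subst.
- move=> e c1 c2 st st' t _ IH s2 t2 H; inversion H as
    [| | | |? ? ? ? ? ? K| |]; subst.
  by have [? ?] := IH _ _ K; subst.
- move=> e c st Hn s2 t2 H; inversion H as
    [| | | | | |? ? ? ? ? ? ? K]; subst => //.
  by rewrite K in Hn.
- move=> e c s1 s2 s3 t1 t2 Ht _ IH1 _ IH2 st t H; inversion H as
    [| | | | |? ? ? K|? ? ? s ? ? ? ? K1 K2]; subst.
    by rewrite Ht in K.
  have [? ?] := IH1 _ _ K1; subst.
  by have [? ?] := IH2 _ _ K2; subst.
Qed.

(* The input is read from, and the output left in, variable 0. *)
Definition init (v : val R) : store := fun x => if x == 0%N then v else VNil.

End Semantics.

Definition unit_size (R : Type) (x : R) : nat := 1.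

Definition bitlen (n : nat) : nat := (trunc_log 2 n).+1.

Definition bit_size (q : rat) : nat :=
  (bitlen `|numq q|%N + bitlen `|denq q|%N)%N.

(** * Minimization problems and approximation algorithms *)

(* The solutions of instance [I] are subsets of [ground I]. [encode I] is the
   explicit part of the input, [oracle I] the part that is accessed by queries. *)
Record problem (R : realFieldType) := Problem {
  instance : Type;
  ground : instance -> finType;
  feasible : forall I : instance, {set ground I} -> bool;
  objective : forall I : instance, {set ground I} -> \bar R;
  encode : instance -> val R;
  oracle : instance -> val R -> bool
}.

Definition opt (R : realFieldType) (P : problem R) (I : instance P) : \bar R :=
  \big[Order.min/+oo%E]_(S : {set ground I} | feasible S) objective S.

Definition is_approx (R : realFieldType) (P : problem R) (rho : nat)
    (I : instance P) (S : {set ground I}) : Prop :=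
  feasible S /\ (objective S <= rho%:R%:E * opt I)%E.

Definition approximates_in_time (R : realFieldType) (P : problem R)
    (sz : R -> nat) (rho : nat) (p : cmd) (bound : nat -> nat) : Prop :=
  forall I : instance P, exists (st : store R) (t : nat),
    [/\ exec sz (oracle I) p (init (encode I)) st t,
        (t <= bound (vsize sz (encode I)))%N
      & is_approx rho (set_of (ground I) (st 0%N))].

Definition poly_bound (c n : nat) : nat := (c * n ^ c + c)%N.

(* One program, polynomial both on real inputs with unit-cost arithmetic and on
   rational inputs with respect to bit complexity. *)
Definition has_polytime_approx
    (P : forall R : realFieldType, problem R) (rho : nat) : Prop :=
  exists (p : cmd) (c : nat),
    (forall R : realType,
       approximates_in_time (P R) (@unit_size R) rho p (poly_bound c))
    /\ approximates_in_time (P rat) bit_size rho p (poly_bound c).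

(** * The priority problems *)

Definition is_metric (R : realFieldType) (T : Type) (d : T -> T -> R) : Prop :=
  [/\ forall x y, 0 <= d x y,
      forall x y, d x y = 0 <-> x = y,
      forall x y, d x y = d y x
    & forall x y z, d x z <= d x y + d y z].

Definition dist_to (R : realFieldType) (V T : finType) (d : V -> T -> R)
    (v : V) (S : {set T}) : \bar R :=
  \big[Order.min/+oo%E]_(s in S) (d v s)%:E.

Definition priority_radius (R : realFieldType) (V T : finType)
    (d : V -> T -> R) (r : V -> R) (S : {set T}) : \bar R :=
  \big[Order.max/0%E]_(v : V) (dist_to d v S / (r v)%:E)%E.

Definition enc_matrix (R : Type) (T : Type) (s : seq T) (d : T -> T -> R) : val R :=
  vlist [seq vnums [seq d x y | y <- s] | x <- s].

Record supplier_inst (R : realFieldType) := SupplierInst {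
  sup_F : finType;
  sup_C : finType;
  sup_d : sup_F + sup_C -> sup_F + sup_C -> R;
  sup_r : sup_C -> R;
  sup_k : nat;
  sup_metric : is_metric sup_d;
  sup_r_gt0 : forall v, 0 < sup_r v
}.

Definition priority_k_supplier (R : realFieldType) : problem R :=
  @Problem R (supplier_inst R) (@sup_F R)
    (fun I S => #|S| <= sup_k I)%N
    (fun I S => priority_radius (fun v s => sup_d (inr v) (inl s)) (@sup_r R I) S)
    (fun I =>
       VPair (enc_matrix
                ([seq inl f | f <- enum (sup_F I)] ++
                 [seq inr v | v <- enum (sup_C I)]) (@sup_d R I))
         (VPair (vnums [seq sup_r v | v <- enum (sup_C I)])
            (VNum (sup_k I)%:R)))
    (fun _ _ => false).

Record knapsack_inst (R : realFieldType) := KnapsackInst {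
  kna_X : finType;
  kna_d : kna_X -> kna_X -> R;
  kna_r : kna_X -> R;
  kna_w : kna_X -> R;
  kna_B : R;
  kna_metric : is_metric kna_d;
  kna_r_gt0 : forall v, 0 < kna_r v;
  kna_w_ge0 : forall v, 0 <= kna_w v;
  kna_B_gt0 : 0 < kna_B
}.

Definition priority_knapsack_center (R : realFieldType) : problem R :=
  @Problem R (knapsack_inst R) (@kna_X R)
    (fun I S => \sum_(u in S) kna_w u <= kna_B I)
    (fun I S => priority_radius (@kna_d R I) (@kna_r R I) S)
    (fun I =>
       VPair (enc_matrix (enum (kna_X I)) (@kna_d R I))
         (VPair (vnums [seq kna_r v | v <- enum (kna_X I)])
            (VPair (vnums [seq kna_w v | v <- enum (kna_X I)])
               (VNum (kna_B I)))))
    (fun _ _ => false).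

Record matroid (T : finType) := Matroid {
  indep : {set {set T}};
  indep0 : set0 \in indep;
  indep_sub : forall A B : {set T}, A \subset B -> B \in indep -> A \in indep;
  indep_exchange : forall A B : {set T},
    A \in indep -> B \in indep -> (#|A| < #|B|)%N ->
    exists2 x, x \in B :\: A & x |: A \in indep
}.

Record matroid_inst (R : realFieldType) := MatroidInst {
  mat_X : finType;
  mat_d : mat_X -> mat_X -> R;
  mat_r : mat_X -> R;
  mat_M : matroid mat_X;
  mat_metric : is_metric mat_d;
  mat_r_gt0 : forall v, 0 < mat_r v
}.

(* The matroid is accessed through an independence oracle. *)
Definition priority_matroid_center (R : realFieldType) : problem R :=
  @Problem R (matroid_inst R) (@mat_X R)
    (fun I S => S \in indep (mat_M I))
    (fun I S => priority_radius (@mat_d R I) (@mat_r R I) S)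
    (fun I =>
       VPair (enc_matrix (enum (mat_X I)) (@mat_d R I))
         (vnums [seq mat_r v | v <- enum (mat_X I)]))
    (fun I v => set_of (mat_X I) v \in indep (mat_M I)).

(* Main.v *)
(** Guess the optimal ratio [rho] among the quotients [d v f / r v]. Scan the
    clients by increasing radius and make a client [v] a representative unless
    [d u v <= rho (r u + r v)] for an earlier representative [u]. The balls of
    radius [rho r v] around the representatives are then disjoint and every
    solution of value [rho] meets all of them; conversely a set that meets all of
    them has value at most [3 rho]. It remains to find a feasible set meeting
    given disjoint balls: take the cheapest point of each ball for a knapsack
    (and unit weights for a cardinality constraint), and augment along paths of
    the exchange graph for a matroid.

    The algorithms are written in a small functional language whose loops are
    folds over lists no longer than the input, and in which numbers are summed and
    multiplied for comparisons only, never stored. Hence every compiled program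
    runs in polynomial time, and only values remain to be reasoned about. *)

From mathcomp Require Import all_boot all_order all_algebra.
From mathcomp Require Import reals constructive_ereal zify ring lra.
Require Import Defs.
Set Implicit Arguments.
Unset Strict Implicit.
Unset Printing Implicit Defensive.
Import Order.TTheory GRing.Theory Num.Theory.
Local Open Scope ring_scope.

(** * A functional language and its compiler *)

(** One number [N], the row count of the matrix plus two, is the fuel of every loop, nested ones
    included. The running time of a compiled term is therefore bounded by a polynomial read off its
    syntax, whatever the term computes. The price is truncation: a fold silently drops the items
    beyond the first [N], so each correctness proof has to show that its list is short enough. Trees
    may grow and share freely, since structural operations cost one unit; only the leaves need a
    size bound. The ratio is kept as a fraction [d0 / r0] of two input numbers, and comparisons are
    cleared of denominators. For a matroid, meeting all the balls is a matroid intersection problem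
    with the partition matroid of the balls. A failed search has to show that no independent set
    meets them all; this is done by one exchange argument against a hypothetical solution, not
    through a rank formula. *)

Inductive fn : Type :=
| FArg
| FNil
| FOne
| FPair of fn & fn
| FFst of fn
| FSnd of fn
| FIf of fn & fn & fn
| FComp of fn & fn
| FAsk of fn
| FSumLe of fn & fn & fn & fn
| FFold of fn & fn & fn & fn.

Section Denotation.
Variables (R : realFieldType) (oracle : val R -> bool) (N : nat).

Definition fstv (v : val R) : val R := if v is VPair a _ then a else VNil.
Definition sndv (v : val R) : val R := if v is VPair _ b then b else VNil.

(* The items that a loop popping pairs until [VNil] meets; it treats a number
   as a one-item list. *)
Fixpoint spine (v : val R) : seq (val R) :=
  match v with
  | VNil => [::]
  | VNum _ => [:: VNil]
  | VPair a b => a :: spine b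
  end.

Definition vadd (u v : val R) : val R :=
  match u, v with VNum x, VNum y => VNum (x + y) | _, _ => VNil end.
Definition vmul (u v : val R) : val R :=
  match u, v with VNum x, VNum y => VNum (x * y) | _, _ => VNil end.
Definition vle (u v : val R) : val R :=
  match u, v with VNum x, VNum y => vbool R (x <= y) | _, _ => VNil end.
Definition vsum (v : val R) : val R := foldl vadd (VNum 0) (take N (spine v)).
Definition vsumle (l x y l' : val R) : val R :=
  vle (vmul (vsum l) x) (vmul y (vsum l')).

Fixpoint feval (f : fn) (v : val R) : val R :=
  match f with
  | FArg => v
  | FNil => VNil
  | FOne => VNum 1
  | FPair f g => VPair (feval f v) (feval g v)
  | FFst f => fstv (feval f v)
  | FSnd f => sndv (feval f v)
  | FIf f g h => if truthy (feval f v) then feval g v else feval h v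
  | FComp f g => feval f (feval g v)
  | FAsk f => vbool R (oracle (feval f v))
  | FSumLe f1 f2 f3 f4 =>
      vsumle (feval f1 v) (feval f2 v) (feval f3 v) (feval f4 v)
  | FFold b l i c =>
      foldl (fun acc x => feval b (VPair acc (VPair x (feval c v))))
            (feval i v) (take N (spine (feval l v)))
  end.

End Denotation.
Arguments vadd {R}.

(* Runs [body] once for each item of the list in variable [l], at most as often
   as the list in variable 0 is long; [f] is a scratch variable. *)
Definition loop (l f : nat) (body : cmd) : cmd :=
  Seq (Assign f (EVar 0))
   (While (EVar f)
     (Seq (Assign f (ESnd (EVar f)))
       (If (EVar l) (Seq body (Assign l (ESnd (EVar l)))) Skip))).

Definition sum_loop (l s : nat) : cmd :=
  Seq (Assign s (ENum 0))
   (Seq (loop l s.+1 (Assign s (EOp Add (EVar s) (EFst (EVar l)))))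
        (Assign l (EVar s))).

(* [compile f a t] reads its argument in variable [a], leaves its result in
   variable [t] and preserves the variables below [t]. *)
Fixpoint compile (f : fn) (a t : nat) : cmd :=
  match f with
  | FArg => Assign t (EVar a)
  | FNil => Assign t ENil
  | FOne => Assign t (ENum 1)
  | FPair f g =>
      Seq (compile f a t)
        (Seq (compile g a t.+1) (Assign t (EPair (EVar t) (EVar t.+1))))
  | FFst f => Seq (compile f a t) (Assign t (EFst (EVar t)))
  | FSnd f => Seq (compile f a t) (Assign t (ESnd (EVar t)))
  | FIf f g h => Seq (compile f a t) (If (EVar t) (compile g a t) (compile h a t))
  | FComp f g =>
      Seq (compile g a t) (Seq (compile f t t.+1) (Assign t (EVar t.+1)))
  | FAsk f => Seq (compile f a t) (Query t (EVar t))
  | FSumLe f1 f2 f3 f4 =>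
      Seq (compile f1 a t)
      (Seq (compile f2 a t.+1)
      (Seq (compile f3 a t.+2)
      (Seq (compile f4 a t.+3)
      (Seq (sum_loop t t.+4)
      (Seq (sum_loop t.+3 t.+4)
           (Assign t (ELe (EOp Mul (EVar t) (EVar t.+1))
                          (EOp Mul (EVar t.+2) (EVar t.+3)))))))))
  | FFold b l i c =>
      Seq (compile l a t)
      (Seq (compile i a t.+1)
      (Seq (compile c a t.+2)
      (Seq (loop t t.+3
             (Seq (Assign t.+4 (EPair (EVar t.+1)
                                 (EPair (EFst (EVar t)) (EVar t.+2))))
             (Seq (compile b t.+4 t.+4.+1)
                  (Assign t.+1 (EVar t.+4.+1)))))
           (Assign t (EVar t.+1)))))
  end.

(** * Syntactic time bounds and their polynomial growth *)

Section TimeBound.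
Local Open Scope nat_scope.

(** A sum of at most [N] numbers of height [H] has height at most [1 + N * H], a product with one
    more adds [H], and a size is at most twice a height plus 2; the factors are rounded up. *)
Definition size_bound (N H : nat) : nat := 2 * ((N + 2) * (H + 1)) + 2.

(** Both branches of [FIf] are charged, so that no value enters the bound. *)
Fixpoint time_bound (f : fn) (N H : nat) : nat :=
  match f with
  | FArg | FNil | FOne => 10
  | FPair f g | FComp f g => time_bound f N H + time_bound g N H + 10
  | FFst f | FSnd f | FAsk f => time_bound f N H + 10
  | FIf f g h => time_bound f N H + time_bound g N H + time_bound h N H + 10
  | FSumLe f1 f2 f3 f4 =>
      time_bound f1 N H + time_bound f2 N H + time_bound f3 N H
      + time_bound f4 N H + 2 * N * (3 * size_bound N H + 30)
      + 10 * size_bound N H + 100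
  | FFold b l i c =>
      time_bound l N H + time_bound i N H + time_bound c N H
      + N * (time_bound b N H + 50) + 50
  end.

(** As [n + 2] is at least 2, its powers absorb constants and sums, and closure under the operations
    of [time_bound] needs only a larger exponent. *)
Definition polynomial (F : nat -> nat) : Prop := exists c, forall n, F n <= (n + 2) ^ c.

Lemma polynomial_const k : polynomial (fun=> k).
Proof.
exists k => n; apply: leq_trans (ltnW (ltn_expl k (isT : 1 < 2))) _.
by case: k => // k; rewrite leq_exp2r // leq_addl.
Qed.

Lemma polynomial_shift k : polynomial (fun n => n + k).
Proof.
exists k.+1 => n; have k2 := ltn_expl k (isT : 1 < 2).
rewrite expnS; have : 2 ^ k <= (n + 2) ^ k.
  by case: (k) => // k'; rewrite leq_exp2r // leq_addl.
nia.
Qed.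

Lemma polynomialD F G :
  polynomial F -> polynomial G -> polynomial (fun n => F n + G n).
Proof.
move=> [a Fa] [b Gb]; exists (a + b).+1 => n.
have := Fa n; have := Gb n; rewrite expnS expnD.
have : 0 < (n + 2) ^ a by rewrite expn_gt0 addn2.
have : 0 < (n + 2) ^ b by rewrite expn_gt0 addn2.
nia.
Qed.

Lemma polynomialM F G :
  polynomial F -> polynomial G -> polynomial (fun n => F n * G n).
Proof.
by move=> [a Fa] [b Gb]; exists (a + b) => n; rewrite expnD leq_mul.
Qed.

(** For [n > 0], [n + 2 <= 3 * n] turns [(n + 2) ^ c] into [3 ^ c * n ^ c]; since [c <= 3 ^ c], the
    number [3 ^ c] serves as coefficient and as exponent. At [n = 0] the additive term takes
    over. *)
Lemma polynomial_poly_bound F :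
  polynomial F -> exists c, forall n, F n <= poly_bound c n.
Proof.
move=> [c Fc]; exists (3 ^ c) => n; apply: leq_trans (Fc n) _.
have c3 : c <= 3 ^ c by apply/ltnW/ltn_expl.
rewrite /poly_bound; case: n => [|n].
  apply: leq_trans (leq_addl _ _); rewrite add0n.
  by case: (c) => // k; rewrite leq_exp2r.
apply: leq_trans (leq_addr _ _).
apply: (@leq_trans (3 ^ c * n.+1 ^ c)); last by rewrite leq_mul2l leq_pexp2l ?orbT.
rewrite -expnMn; case: (c) => // k; rewrite leq_exp2r //; lia.
Qed.

Lemma time_bound_mono f N N' H :
  N <= N' -> time_bound f N H <= time_bound f N' H.
Proof.
move=> NN'; elim: f => /= *; rewrite /size_bound;
  by do ![assumption | exact: leqnn | apply: leq_add | apply: leq_mul].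
Qed.

Lemma polynomial_time_bound f :
  polynomial (fun n => time_bound f (n + 2) (n + 1)).
Proof.
elim: f => /= *; rewrite /size_bound;
  by do ![assumption | exact: polynomial_const | exact: polynomial_shift
         | apply: polynomialD | apply: polynomialM].
Qed.

End TimeBound.

(** * Correctness and cost of compiled programs *)

Section Compiler.
Variables (R : realFieldType) (sz : R -> nat) (orc : val R -> bool).

(* A logarithmic height: subadditive under the arithmetic operations and equal
   to the size up to constants. *)
Definition tame : Prop := exists h : R -> nat,
  [/\ forall x, (h x <= sz x)%N, forall x, (sz x <= 2 * h x + 2)%N,
      (h 0%R <= 1)%N, (h 1%R <= 1)%N
    & forall x y, (h (x + y)%R <= h x + h y)%N /\ (h (x * y)%R <= h x + h y)%N].

Definition runs (c : cmd) (st : store R) (T : nat) (Q : store R -> Prop) : Prop :=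
  exists (st' : store R) (t : nat), [/\ exec sz orc c st st' t, (t <= T)%N & Q st'].

Lemma runs_assign x e st (Q : store R -> Prop) T :
  (ecost sz st e < T)%N -> Q (upd st x (eval st e)) -> runs (Assign x e) st T Q.
Proof. by move=> eT Qe; do 2!eexists; split; [exact: exec_assign | | ]. Qed.

Lemma runs_seq c1 c2 st T1 T2 (Q1 Q : store R -> Prop) T :
  runs c1 st T1 Q1 -> (forall st', Q1 st' -> runs c2 st' T2 Q) ->
  (T1 + T2 < T)%N -> runs (Seq c1 c2) st T Q.
Proof.
move=> [s1 [t1 [e1 b1 q1]]] /(_ _ q1) [s2 [t2 [e2 b2 q2]]] leT.
exists s2, (t1 + t2).+1; split=> //; first exact: exec_seq e1 e2.
by apply: leq_trans leT; rewrite ltnS leq_add.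
Qed.

Lemma runs_weaken c st T T' (Q Q' : store R -> Prop) :
  runs c st T Q -> (T <= T')%N -> (forall st', Q st' -> Q' st') -> runs c st T' Q'.
Proof.
move=> [s [t [e b q]]] leT QQ'; exists s, t; split=> //; last exact: QQ'.
exact: leq_trans leT.
Qed.

Lemma upd_ne (st : store R) x v y : y != x -> upd st x v y = st y.
Proof. by rewrite /upd => /negPf->. Qed.

Lemma upd_eq (st : store R) x v : upd st x v x = v.
Proof. by rewrite /upd eqxx. Qed.

Lemma spine_step (v : val R) : truthy v -> spine v = fstv v :: spine (sndv v).
Proof. by case: v. Qed.

Lemma spine_stop (v : val R) : ~~ truthy v -> spine v = [::].
Proof. by case: v. Qed.

(** The second argument of [Inv] is the list of items still to come, cut to the remaining fuel. The
    stability hypotheses are there because the loop itself overwrites [f] and [l]. If [l] runs out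
    first, the remaining rounds only burn fuel. *)
Lemma runs_loop (l f : nat) body (st : store R) (Inv : store R -> seq (val R) -> Prop) T :
  f != l -> l != 0%N -> f != 0%N ->
  (forall (st : store R) v, Inv st v -> forall w, Inv (upd st f w) v) ->
  (forall (st : store R) v, Inv st v -> forall w, Inv (upd st l w) v) ->
  (forall (st : store R) v, truthy (st l) -> Inv st (fstv (st l) :: v) ->
     runs body st T (fun st' =>
       [/\ Inv st' v, st' l = st l, st' f = st f & st' 0%N = st 0%N])) ->
  let N := size (spine (st 0%N)) in
  Inv st (take N (spine (st l))) ->
  runs (loop l f body) st (N * (T + 20) + 10)%N
    (fun st' => Inv st' [::] /\ st' 0%N = st 0%N).
Proof.
move=> fl l0 f0 Iuf Iul bodyP N.
rewrite /loop; set W := While _ _.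
have WP : forall n (st1 : store R), size (spine (st1 f)) = n -> st1 0%N = st 0%N ->
    Inv st1 (take n (spine (st1 l))) ->
    runs W st1 (n * (T + 20) + 4)%N (fun st' => Inv st' [::] /\ st' 0%N = st 0%N).
  elim=> [|n IH] st1 sn s0 I1.
    have nt : ~~ truthy (st1 f) by move: sn; case: (st1 f).
    exists st1, 2; split=> //; first exact: exec_while_stop.
    by split=> //; move: I1; rewrite take0.
  have tf : truthy (st1 f) by move: sn; case: (st1 f).
  set st2 := upd st1 f (sndv (st1 f)).
  have sn2 : size (spine (st2 f)) = n.
    by rewrite /st2 upd_eq; move: sn; rewrite spine_step // => -[].
  have st2l : st2 l = st1 l by rewrite /st2 upd_ne // eq_sym.
  have s02 : st2 0%N = st 0%N by rewrite /st2 upd_ne // eq_sym.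
  have I2 : Inv st2 (take n.+1 (spine (st1 l))) by apply: Iuf.
  have /= E2 := exec_assign sz orc f (ESnd (EVar f)) st1.
  case tl: (truthy (st1 l)); last first.
    have nl : spine (st1 l) = [::] by rewrite spine_stop ?tl.
    have [|//||s3 [t3 [e3 b3 q3]]] := IH st2; first by rewrite sn2.
      by rewrite st2l nl; move: I2; rewrite nl.
    have Ei : exec sz orc (If (EVar l) (Seq body (Assign l (ESnd (EVar l)))) Skip)
                st2 st2 (1 + 1).+1.
      by apply: exec_if; rewrite /= st2l tl; exact: exec_skip.
    have Ew := exec_while_step (e := EVar f) tf (exec_seq E2 Ei) e3.
    by exists s3; eexists; split; [exact: Ew | move: b3 => /=; lia | exact: q3].
  have := I2; rewrite spine_step //= => I2'.
  have [s3 [t3 [e3 b3 [I3 s3l s3f s30]]]] :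
     runs body st2 T (fun st' =>
       [/\ Inv st' (take n (spine (sndv (st1 l)))), st' l = st2 l,
           st' f = st2 f & st' 0%N = st2 0%N]).
    by apply: bodyP; rewrite st2l.
  set st4 := upd s3 l (sndv (s3 l)).
  have [|||s5 [t5 [e5 b5 q5]]] := IH st4.
  - by rewrite /st4 upd_ne // s3f.
  - by rewrite /st4 upd_ne 1?eq_sym // s30.
  - by rewrite /st4 upd_eq s3l st2l; exact: Iul.
  have /= E4 := exec_assign sz orc l (ESnd (EVar l)) s3.
  have Ei : exec sz orc (If (EVar l) (Seq body (Assign l (ESnd (EVar l)))) Skip)
                st2 st4 (1 + (t3 + 3).+1).+1.
    by apply: exec_if; rewrite /= st2l tl; exact: exec_seq e3 E4.
  have Ew := exec_while_step (e := EVar f) tf (exec_seq E2 Ei) e5.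
  by exists s5; eexists; split; [exact: Ew | move: b5 => /=; lia | exact: q5].
move=> I0; have /= E := exec_assign sz orc f (EVar 0) st.
have [|||s [t [e b q]]] := WP N (upd st f (st 0%N)).
- by rewrite upd_eq.
- by rewrite upd_ne // eq_sym.
- by rewrite [upd st f (st 0%N) l]upd_ne 1?eq_sym //; exact: Iuf.
by exists s; eexists; split; [exact: exec_seq E e | move: b => /=; lia | ].
Qed.

Section Bounds.
Variables (h : R -> nat) (H : nat).
Hypothesis h_sz : forall x, (sz x <= 2 * h x + 2)%N.
Hypothesis h0 : (h 0%R <= 1)%N.
Hypothesis h1 : (h 1%R <= 1)%N.
Hypothesis hD : forall x y, (h (x + y)%R <= h x + h y)%N.
Hypothesis hM : forall x y, (h (x * y)%R <= h x + h y)%N.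
Hypothesis H_gt0 : (0 < H)%N.

Fixpoint low (v : val R) : bool :=
  match v with
  | VNil => true
  | VNum x => (h x <= H)%N
  | VPair a b => low a && low b
  end.

Definition vheight (v : val R) : nat := if v is VNum x then h x else 0%N.

Lemma low_fstv v : low v -> low (fstv v).
Proof. by case: v => //= a b /andP[]. Qed.

Lemma low_sndv v : low v -> low (sndv v).
Proof. by case: v => //= a b /andP[]. Qed.

Lemma low_spine v : low v -> all low (spine v).
Proof. by elim: v => //= a _ b IH /andP[-> /IH]. Qed.

Lemma low_vbool b : low (vbool R b).
Proof. by case: b. Qed.

Lemma low_vheight v : low v -> (vheight v <= H)%N.
Proof. by case: v. Qed.

Lemma all_take (T : Type) (p : pred T) n (s : seq T) : all p s -> all p (take n s).
Proof. by move=> ps; move: (ps); rewrite -{1}(cat_take_drop n s) all_cat => /andP[]. Qed.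

(** The only number a term creates is the constant 1, which [H_gt0] admits; all other leaves of the
    result come from the argument. *)
Lemma low_feval N f v : low v -> low (feval orc N f v).
Proof.
elim: f v => //=.
- by move=> _ _; exact: (leq_trans h1 H_gt0).
- by move=> f IHf g IHg v lv; rewrite IHf ?IHg.
- by move=> f IHf v lv; rewrite low_fstv ?IHf.
- by move=> f IHf v lv; rewrite low_sndv ?IHf.
- by move=> f IHf g IHg k IHk v lv; case: ifP => _; [exact: IHg | exact: IHk].
- by move=> f IHf g IHg v lv; rewrite IHf ?IHg.
- by move=> *; rewrite low_vbool.
- move=> f1 _ f2 _ f3 _ f4 _ v _; rewrite /vsumle /vle.
  by case: vmul => // x; case: vmul => // y; rewrite low_vbool.
- move=> b IHb l IHl i IHi c IHc v lv.
  have ls : all low (take N (spine (feval orc N l v))).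
    by rewrite all_take // low_spine ?IHl.
  have lc : low (feval orc N c v) by exact: IHc.
  elim: (take _ _) (feval _ _ i v) (IHi _ lv) ls => //= x s IH acc la /andP[lx ls].
  by apply: IH => //; apply: IHb; rewrite /= la lx.
Qed.

Lemma num_size_le v : (num_size sz v <= 2 * vheight v + 2)%N.
Proof. by case: v => //= x; exact: h_sz. Qed.

Lemma sz_small x : (h x <= 1)%N -> (sz x <= 4)%N.
Proof. by move=> hx; apply: leq_trans (h_sz x) _; lia. Qed.

Lemma vheight_add u v : (vheight (vadd u v) <= vheight u + vheight v)%N.
Proof. by case: u v => [|x|? ?] [|y|? ?] //=; exact: hD. Qed.

Lemma vheight_mul u v : (vheight (vmul u v) <= vheight u + vheight v)%N.
Proof. by case: u v => [|x|? ?] [|y|? ?] //=; exact: hM. Qed.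

Lemma foldl_vadd_height s v : all low s ->
  (vheight (foldl vadd v s) <= vheight v + size s * H)%N.
Proof.
elim: s v => [|x s IH] v /=; first by rewrite addn0.
move=> /andP[lx ls]; apply: leq_trans (IH _ ls) _.
have := vheight_add v x; have := low_vheight lx; lia.
Qed.

Lemma vsum_height N v : low v -> (vheight (vsum N v) <= 1 + N * H)%N.
Proof.
move=> lv; apply: leq_trans (foldl_vadd_height _ (all_take N (low_spine lv))) _.
rewrite leq_add // leq_mul2r size_take_min geq_minl orbT //.
Qed.

Lemma eval_mul (st : store R) a b : eval st (EOp Mul a b) = vmul (eval st a) (eval st b).
Proof. by []. Qed.

Lemma eval_le (st : store R) a b : eval st (ELe a b) = vle (eval st a) (eval st b).
Proof. by []. Qed.

Lemma runs_sum (l s : nat) (st : store R) :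
  l != 0%N -> s != 0%N -> (l < s)%N -> low (st l) ->
  let N := size (spine (st 0%N)) in
  runs (sum_loop l s) st (N * (3 * size_bound N H + 30) + 30)%N
    (fun st' => st' l = vsum N (st l) /\
       forall y, (y < s)%N -> y != l -> st' y = st y).
Proof.
move=> l0 s0 ls lowl N.
(* The third clause is a potential: each pending item may raise the height by [H], so the
   accumulator never exceeds [1 + N * H]. The 1 is for the initial 0. *)
pose Inv (st1 : store R) q := [/\ foldl vadd (st1 s) q = vsum N (st l),
   all low q, (vheight (st1 s) + size q * H <= 1 + N * H)%N
   & forall y, (y < s)%N -> y != l -> st1 y = st y].
have ltake : all low (take N (spine (st l))) by rewrite all_take ?low_spine.
apply: (@runs_seq _ _ _ 6 (N * (3 * size_bound N H + 30) + 20)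
   (fun st1 => st1 = upd st s (VNum 0))).
- by apply: runs_assign => //=; exact: (sz_small h0).
- move=> st1 ->.
  apply: (@runs_seq _ _ _ (N * ((3 * size_bound N H + 10) + 20) + 10) 3
            (fun st1 => Inv st1 [::] /\ st1 0%N = st 0%N)).
  + have N1 : size (spine (upd st s (VNum 0) 0%N)) = N.
      by rewrite upd_ne // eq_sym.
    have l1 : upd st s (VNum 0) l = st l by rewrite upd_ne //; lia.
    rewrite -{1}N1 -[st 0%N](@upd_ne st s (VNum 0)) 1?eq_sym //.
    apply: runs_loop => //; try by lia.
    * move=> st2 q [A1 A2 A3 A4] w; split=> //.
      - by rewrite upd_ne //; lia.
      - by rewrite upd_ne //; lia.
      - by move=> y ys yl; rewrite upd_ne ?A4 //; lia.
    * move=> st2 q [A1 A2 A3 A4] w; split=> //.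
      - by rewrite upd_ne //; lia.
      - by rewrite upd_ne //; lia.
      - by move=> y ys yl; rewrite upd_ne ?A4 //; lia.
    * move=> st2 q tl [/= A1 /andP[A2 A2'] A3 A4].
      have hx := low_vheight A2.
      have va := vheight_add (st2 s) (fstv (st2 l)).
      apply: runs_assign.
      - change (ecost sz st2 (EOp Add (EVar s) (EFst (EVar l)))) with
         (1 + 2 + num_size sz (st2 s) + num_size sz (fstv (st2 l)) +
          num_size sz (vadd (st2 s) (fstv (st2 l)))).+1%N.
        have := num_size_le (st2 s); have := num_size_le (fstv (st2 l)).
        have := num_size_le (vadd (st2 s) (fstv (st2 l))).
        move: A3; rewrite /size_bound mulSn; nia.
      - change (eval st2 _) with (vadd (st2 s) (fstv (st2 l))).
        split; rewrite ?upd_ne //; try by lia.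
        split=> //; rewrite ?upd_eq //.
        + move: A3; rewrite mulSn; rewrite /= in va *; lia.
        + by move=> y ys yl; rewrite upd_ne ?A4 //; lia.
    * rewrite N1 l1; split=> //; first by rewrite upd_eq.
      - rewrite upd_eq /= leq_add // leq_mul2r size_take_min geq_minl orbT //.
      - by move=> y ys yl; rewrite upd_ne //; lia.
  + move=> st2 [[A1 A2 A3 A4] A5]; apply: runs_assign => //=.
    split; first by rewrite upd_eq -A1.
    by move=> y ys yl; rewrite upd_ne ?A4 //.
  + lia.
- lia.
Qed.

Lemma runs_stage c1 c2 (st : store R) t v T1 T2 T (Q : store R -> Prop) :
  runs c1 st T1 (fun st' => st' t = v /\ forall y, (y < t)%N -> st' y = st y) ->
  (forall st', st' t = v -> (forall y, (y < t)%N -> st' y = st y) ->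
     runs c2 st' T2 Q) ->
  (T1 + T2 < T)%N -> runs (Seq c1 c2) st T Q.
Proof. by move=> r1 r2; apply: (runs_seq r1) => st' [? ?]; exact: r2. Qed.

Lemma runs_assign_last (st st0 : store R) t e v T :
  (ecost sz st e < T)%N -> eval st e = v ->
  (forall y, (y < t)%N -> st y = st0 y) ->
  runs (Assign t e) st T (fun st' => st' t = v /\ forall y, (y < t)%N -> st' y = st0 y).
Proof.
move=> eT ev A; apply: runs_assign => //; split=> [|y yt]; first by rewrite upd_eq.
by rewrite upd_ne ?A //; lia.
Qed.

(** Variables act as a stack: each subprogram leaves everything below its own target intact, so
    [a < t] protects the argument and [0 < t] protects the fuel in variable 0, which all nested
    loops read. *)
Lemma compileP f a t (st : store R) u N :
  (a < t)%N -> (0 < t)%N -> st a = u -> low u -> size (spine (st 0%N)) = N ->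
  runs (compile f a t) st (time_bound f N H)
    (fun st' => st' t = feval orc N f u /\
                forall y, (y < t)%N -> st' y = st y).
Proof.
elim: f a t st u N => [|||f IHf g IHg|f IHf|f IHf|f IHf g IHg k IHk|f IHf g IHg|f IHf
  |f1 IH1 f2 IH2 f3 IH3 f4 IH4|b IHb l IHl i IHi c IHc] a t st u N at_ t0 au lu sN /=.
- exact: runs_assign_last.
- exact: runs_assign_last.
- by apply: runs_assign_last => //=; exact: (leq_trans (sz_small h1)).
- apply: runs_stage (IHf _ _ _ _ _ at_ t0 au lu sN) _ _ => [st1 t1 A1|].
    apply: runs_stage (IHg a t.+1 st1 u N _ _ _ lu _) _ _ => [||||st2 t2 A2|];
      rewrite ?A1 //; first by lia.
    + apply: (runs_assign_last (T := 4)) => //=; first by rewrite A2 // t1 t2.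
      by move=> y yt; rewrite A2 ?A1 //; lia.
  lia.
- apply: runs_stage (IHf _ _ _ _ _ at_ t0 au lu sN) _ _ => [st1 t1 A1|].
    by apply: (runs_assign_last (T := 4)) => //=; rewrite t1.
  lia.
- apply: runs_stage (IHf _ _ _ _ _ at_ t0 au lu sN) _ _ => [st1 t1 A1|].
    by apply: (runs_assign_last (T := 4)) => //=; rewrite t1.
  lia.
- apply: (runs_stage (T2 := time_bound g N H + time_bound k N H + 2)
           (IHf _ _ _ _ _ at_ t0 au lu sN)) => [st1 t1 A1|]; last lia.
  have : runs (if truthy (eval st1 (EVar t)) then compile g a t else compile k a t) st1
     (time_bound g N H + time_bound k N H)
     (fun st' => st' t = (if truthy (feval orc N f u) then feval orc N g u
                          else feval orc N k u) /\
                forall y, (y < t)%N -> st' y = st y).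
    rewrite /= t1; case: ifP => _.
    + apply: runs_weaken (IHg a t st1 u N at_ t0 _ lu _) _ _; rewrite ?A1 ?leq_addr //.
      by move=> st2 [t2 A2]; split=> // y yt; rewrite A2 ?A1.
    + apply: runs_weaken (IHk a t st1 u N at_ t0 _ lu _) _ _; rewrite ?A1 ?leq_addl //.
      by move=> st2 [t2 A2]; split=> // y yt; rewrite A2 ?A1.
  move=> [st2 [tm [e2 b2 q2]]]; exists st2, (1 + tm).+1; split=> //; last by lia.
  exact: exec_if e2.
- apply: runs_stage (IHg _ _ _ _ _ at_ t0 au lu sN) _ _ => [st1 t1 A1|].
    apply: runs_stage (IHf t t.+1 st1 _ N _ _ t1 _ _) _ _ => [||||st2 t2 A2|];
      rewrite ?A1 ?low_feval //.
    + apply: (runs_assign_last (T := 4)) => //=.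
      by move=> y yt; rewrite A2 ?A1 //; lia.
  lia.
- apply: (runs_stage (T2 := 4) (IHf _ _ _ _ _ at_ t0 au lu sN)) => [st1 t1 A1|].
    do 2!eexists; split; [exact: exec_query | by [] |].
    rewrite /= t1; split=> [|y yt]; first by rewrite upd_eq.
    by rewrite upd_ne ?A1 //; lia.
  lia.
- pose S := size_bound N H.
  apply: runs_stage (IH1 _ _ _ _ _ at_ t0 au lu sN) _ _ => [st1 t1 A1|].
    apply: runs_stage (IH2 a t.+1 st1 u N _ _ _ lu _) _ _ => [||||st2 t2 A2|];
      rewrite ?A1 //; first by lia.
      apply: runs_stage (IH3 a t.+2 st2 u N _ _ _ lu _) _ _ => [||||st3 t3 A3|];
        rewrite ?A2 ?A1 //; try by lia.
        apply: runs_stage (IH4 a t.+3 st3 u N _ _ _ lu _) _ _ => [||||st4 t4 A4|];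
          rewrite ?A3 ?A2 ?A1 //; try by lia.
          have B0 : st4 0%N = st 0%N by rewrite A4 ?A3 ?A2 ?A1 //; lia.
          have Bt : st4 t = feval orc N f1 u by rewrite A4 ?A3 ?A2 ?t1 //; lia.
          apply: (@runs_seq _ _ _ (N * (3 * S + 30) + 30)
             (N * (3 * S + 30) + 31 + 8 * S + 15)
             (fun st5 => st5 t = vsum N (feval orc N f1 u) /\
                forall y, (y < t.+4)%N -> y != t -> st5 y = st4 y)).
          - have := @runs_sum t t.+4 st4; rewrite B0 sN Bt; apply; rewrite ?low_feval //; lia.
          - move=> st5 [t5 A5].
            apply: (@runs_seq _ _ _ (N * (3 * S + 30) + 30) (8 * S + 15)
             (fun st6 => st6 t.+3 = vsum N (feval orc N f4 u) /\
                forall y, (y < t.+4)%N -> y != t.+3 -> st6 y = st5 y)).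
            + have := @runs_sum t.+3 t.+4 st5; rewrite !A5 ?B0 ?sN ?t4 //; try by lia.
              by apply; rewrite ?low_feval //; lia.
            + move=> st6 [t6 A6].
              have C0 : st6 t = vsum N (feval orc N f1 u) by rewrite A6 //; lia.
              have C1 : st6 t.+1 = feval orc N f2 u.
                by rewrite A6 ?A5 ?A4 ?A3 //; lia.
              have C2 : st6 t.+2 = feval orc N f3 u.
                by rewrite A6 ?A5 ?A4 //; lia.
              apply: runs_assign_last.
              * change (ecost sz st6 (ELe (EOp Mul (EVar t) (EVar t.+1))
                          (EOp Mul (EVar t.+2) (EVar t.+3)))) with
                 ((1 + 1 + num_size sz (st6 t) + num_size sz (st6 t.+1) +
                     num_size sz (vmul (st6 t) (st6 t.+1))).+1 +
                  (1 + 1 + num_size sz (st6 t.+2) + num_size sz (st6 t.+3) +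
                     num_size sz (vmul (st6 t.+2) (st6 t.+3))).+1 +
                  num_size sz (vmul (st6 t) (st6 t.+1)) +
                  num_size sz (vmul (st6 t.+2) (st6 t.+3)) +
                  num_size sz (vle (vmul (st6 t) (st6 t.+1))
                                   (vmul (st6 t.+2) (st6 t.+3)))).+1%N.
                have -> : num_size sz (vle (vmul (st6 t) (st6 t.+1))
                                   (vmul (st6 t.+2) (st6 t.+3))) = 0%N.
                  by case: vmul => // x; case: vmul => // y /=; case: (x <= y).
                rewrite C0 C1 C2 t6.
                have D1 := vsum_height N (low_feval N f1 lu).
                have D4 := vsum_height N (low_feval N f4 lu).
                have D2 := low_vheight (low_feval N f2 lu).
                have D3 := low_vheight (low_feval N f3 lu).
                have D12 := vheight_mul (vsum N (feval orc N f1 u)) (feval orc N f2 u).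
                have D34 := vheight_mul (feval orc N f3 u) (vsum N (feval orc N f4 u)).
                have bS v : (vheight v <= 1 + N * H + H)%N -> (num_size sz v <= S)%N.
                  by have := num_size_le v; rewrite /S /size_bound; nia.
                have := bS _ (leq_trans D1 (leq_addr _ _)).
                have := bS _ (leq_trans D4 (leq_addr _ _)).
                have := bS _ (leq_trans D2 (leq_addl _ _)).
                have := bS _ (leq_trans D3 (leq_addl _ _)).
                have := bS _ (leq_trans D12 (leq_add D1 D2)).
                have D34' := leq_trans D34 (leq_add D3 D4).
                have := bS _ (leq_trans D34' _).
                rewrite addnC leqnn => /(_ isT); lia.
              * by rewrite eval_le !eval_mul /= C0 C1 C2 t6.
              * by move=> y yt; rewrite A6 ?A5 ?A4 ?A3 ?A2 ?A1 //; lia.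
            + lia.
          - exact: leqnn.
  by rewrite -/S; lia.
- apply: runs_stage (IHl _ _ _ _ _ at_ t0 au lu sN) _ _ => [st1 t1 A1|].
    apply: runs_stage (IHi a t.+1 st1 u N _ _ _ lu _) _ _ => [||||st2 t2 A2|];
      rewrite ?A1 //; first by lia.
      apply: runs_stage (IHc a t.+2 st2 u N _ _ _ lu _) _ _ => [||||st3 t3 A3|];
        rewrite ?A2 ?A1 //; try by lia.
        pose cv := feval orc N c u.
        pose G acc x := feval orc N b (VPair acc (VPair x cv)).
        pose Inv (s : store R) q := [/\ foldl G (s t.+1) q =
             foldl G (feval orc N i u) (take N (spine (feval orc N l u))),
             low (s t.+1) && all low q, s t.+2 = cv & 
             forall y, (y < t)%N -> s y = st y].
        have B0 : st3 0%N = st 0%N by rewrite A3 ?A2 ?A1 //; lia.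
        apply: (@runs_seq _ _ _ (N * (time_bound b N H + 16 + 20) + 10) 3
            (fun s => Inv s [::] /\ s 0%N = st3 0%N)).
        - have sN3 : size (spine (st3 0%N)) = N by rewrite B0.
          rewrite -[X in runs _ _ (X * _ + _)]sN3.
          apply: runs_loop; try by lia.
          + move=> s q [E1 E2 E3 E4] w; split; rewrite ?upd_ne //; try by lia.
            by move=> y yt; rewrite upd_ne ?E4 //; lia.
          + move=> s q [E1 E2 E3 E4] w; split; rewrite ?upd_ne //; try by lia.
            by move=> y yt; rewrite upd_ne ?E4 //; lia.
          + move=> s q tt [/= E1 /and3P[E2 E2' E2''] E3 E4].
            have lcv : low cv by rewrite low_feval.
            apply: (@runs_seq _ _ _ 8 (time_bound b N H + 5)
              (fun s1 => s1 = upd s t.+4 (VPair (s t.+1) (VPair (fstv (s t)) cv)))).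
            * by apply: runs_assign => //=; rewrite E3.
            * move=> s1 ->.
              apply: runs_stage (IHb t.+4 t.+4.+1 _ _ N _ _ (upd_eq _ _ _) _ _) _ _.
              - lia.
              - lia.
              - by rewrite /= E2 E2' lcv.
              - by rewrite upd_ne // E4.
              - move=> s2 F1 F2; apply: (runs_assign (T := 3)) => //=.
                split; try by rewrite upd_ne ?F2 ?upd_ne //; lia.
                split.
                + by rewrite upd_eq F1 -E1.
                + by rewrite upd_eq F1 E2'' low_feval //= E2 E2' lcv.
                + by rewrite upd_ne ?F2 ?upd_ne //; lia.
                + by move=> y yt; rewrite upd_ne ?F2 ?upd_ne ?E4 //; lia.
              - lia.
            * lia.
          + have C0 : st3 t = feval orc N l u by rewrite A3 ?A2 ?t1 //; lia.
            have C1 : st3 t.+1 = feval orc N i u by rewrite A3 ?t2 //; lia.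
            rewrite sN3 C0; split; rewrite ?C1 ?low_feval ?all_take ?low_spine //.
            * by rewrite low_feval.
            * by move=> y yt; rewrite A3 ?A2 ?A1 //; lia.
        - by move=> s [[E1 E2 E3 E4] E5]; apply: runs_assign_last.
        - exact: leqnn.
  lia.
Qed.

End Bounds.

Lemma low_vsize h H (v : val R) :
  (forall x, (h x <= sz x)%N) -> (vsize sz v <= H)%N -> low h H v.
Proof.
move=> hsz; elim: v => //= [x|a IHa b IHb] vH; first by apply: leq_trans (ltnW vH).
by rewrite IHa ?IHb //; lia.
Qed.

Lemma size_spine (v : val R) : (size (spine v) <= vsize sz v)%N.
Proof. by elim: v => //= a _ b IH; lia. Qed.

End Compiler.

(* Variable 0 holds the distance matrix as fuel; the two extra items keep the
   two-term sums of a one-point instance from being truncated. *)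
Definition program (f : fn) : cmd :=
  Seq (Assign 1 (EVar 0))
   (Seq (Assign 0 (EPair ENil (EPair ENil (EFst (EVar 0)))))
     (Seq (compile f 1 2) (Assign 0 (EVar 2)))).

Definition fuel (R : realFieldType) (v : val R) : nat := (size (spine (fstv v))).+2.

(** The exponent can be chosen before the field, the size measure and the oracle because
    [time_bound] depends on the syntax of [f] alone; fuel and height are then bounded by the input
    size up to 2 and 1. *)
Theorem program_polytime (f : fn) : exists c, forall (R : realFieldType)
    (sz : R -> nat) (orc : val R -> bool) (v : val R), tame sz ->
  exists (st : store R) (t : nat),
    [/\ exec sz orc (program f) (init v) st t, (t <= poly_bound c (vsize sz v))%N
      & st 0%N = feval orc (fuel v) f v].
Proof.
have [c cP] := polynomial_poly_bound
  (polynomialD (polynomial_time_bound f) (polynomial_const 20)).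
exists c => R sz orc v [h [h_sz sz_h h0 h1 hDM]].
pose N := fuel v; pose H := (vsize sz v + 1)%N.
have H0 : (0 < H)%N by rewrite /H addn1.
pose st1 := upd (init v) 1 v.
pose st2 := upd st1 0 (VPair VNil (VPair VNil (fstv v))).
have lv : low h H v by apply: low_vsize h_sz _; rewrite leq_addr.
have [st3 [t [e3 b3 [q3 _]]]] := @compileP R sz orc h H sz_h h0 h1
  (fun x y => (hDM x y).1) (fun x y => (hDM x y).2) H0 f 1 2 st2 v N isT isT
  erefl lv erefl.
exists (upd st3 0 (st3 2)); eexists; split; last by rewrite upd_eq q3.
  apply: exec_seq; first exact: exec_assign.
  apply: exec_seq; first exact: exec_assign.
  by apply: exec_seq; [exact: e3 | exact: exec_assign].
apply: leq_trans (cP _); rewrite /= addnC.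
have : (time_bound f N H <= time_bound f (vsize sz v + 2) H)%N.
  apply: time_bound_mono; rewrite /N /fuel.
  by case: (v) => [|x|a b] /=; [lia | lia | have := size_spine sz a; lia].
rewrite -/H; lia.
Qed.

(** * Arithmetic sizes *)

Lemma tame_unit_size (R : realFieldType) : tame (@unit_size R).
Proof. by exists (fun=> 1%N). Qed.

(** Adding numerator and denominator gives one quantity that is submultiplicative under both sum and
    product, so its logarithm is subadditive as [tame] requires. *)
Definition rat_height (q : rat) : nat := (`|numq q| + `|denq q|)%N.

(** Reduction to lowest terms only cancels a common nonzero factor. *)
Lemma rat_height_frac (n d : int) :
  d != 0 -> (rat_height (n%:Q / d%:Q) <= `|n| + `|d|)%N.
Proof.
move=> d0; rewrite /rat_height; case: divqP d0 => [|k x k0 _]; first by rewrite eqxx.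
by rewrite !abszM; apply: leq_add; apply: leq_pmull; rewrite absz_gt0.
Qed.

Lemma rat_height_op (x y : rat) :
  (rat_height (x + y) <= rat_height x * rat_height y)%N /\
  (rat_height (x * y) <= rat_height x * rat_height y)%N.
Proof.
have nx := denq_neq0 x; have ny := denq_neq0 y.
have nxy : denq x * denq y != 0 by rewrite mulf_neq0.
have qx : (denq x)%:Q != 0 by rewrite intr_eq0.
have qy : (denq y)%:Q != 0 by rewrite intr_eq0.
split.
  have -> : x + y = (numq x * denq y + numq y * denq x)%:Q / (denq x * denq y)%:Q.
    rewrite -{1}(divq_num_den x) -{1}(divq_num_den y) rmorphD !rmorphM /=.
    by field; rewrite qx qy.
  apply: leq_trans (rat_height_frac _ nxy) _; rewrite /rat_height abszM.
  have absD (a b : int) : (`|(a + b)%R| <= `|a| + `|b|)%N by lia.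
  have := absD (numq x * denq y) (numq y * denq x); rewrite !abszM.
  move: `|(_ + _)%R|%N `|numq x|%N `|numq y|%N `|denq x|%N `|denq y|%N => n a b c d.
  by rewrite mulnDl !mulnDr; lia.
have -> : x * y = (numq x * numq y)%:Q / (denq x * denq y)%:Q.
  rewrite -{1}(divq_num_den x) -{1}(divq_num_den y) !rmorphM /=.
  by field; rewrite qx qy.
apply: leq_trans (rat_height_frac _ nxy) _; rewrite /rat_height !abszM.
by rewrite mulnDl !mulnDr -addnA leq_add // addnA leq_addl.
Qed.

(** The height is [up_log] of [rat_height]: rounding up keeps the logarithm subadditive, whereas
    [trunc_log 2] is 1 at 3 but 3 at 9. *)
Lemma tame_bit_size : tame bit_size.
Proof.
have up_logM m n : (up_log 2 (m * n) <= up_log 2 m + up_log 2 n)%N.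
  by apply: up_log_min => //; rewrite expnD leq_mul // up_logP.
exists (fun q => up_log 2 (rat_height q)); split=> //.
- move=> q; apply: up_log_min => //; rewrite /bit_size /rat_height /bitlen.
  have ltt n : (n < 2 ^ (trunc_log 2 n).+1)%N by exact: trunc_log_ltn.
  have := ltt `|numq q|%N; have := ltt `|denq q|%N; rewrite expnD.
  have p2 n : (2 <= 2 ^ n.+1)%N by rewrite expnS leq_pmulr // expn_gt0.
  have := p2 (trunc_log 2 `|numq q|%N); have := p2 (trunc_log 2 `|denq q|%N); nia.
- move=> q; rewrite /bit_size /bitlen.
  have tl n : (n <= rat_height q)%N -> (trunc_log 2 n <= up_log 2 (rat_height q))%N.
    move=> nq; case: n nq => [|n] nq; first by rewrite trunc_log0.
    rewrite -(leq_exp2l _ _ (isT : 1 < 2)%N); apply: leq_trans (up_logP _ (isT : 1 < 2)%N).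
    exact: leq_trans (trunc_logP (isT : 1 < 2)%N (ltn0Sn n)) nq.
  have := tl _ (leq_addr _ _ : (`|numq q|%N <= rat_height q)%N).
  have := tl _ (leq_addl _ _ : (`|denq q|%N <= rat_height q)%N).
  lia.
- move=> x y; have [D M] := rat_height_op x y; split.
    exact: leq_trans (leq_up_log _ D) (up_logM _ _).
  exact: leq_trans (leq_up_log _ M) (up_logM _ _).
Qed.

(** * Arrays and masks *)

Definition FTrue : fn := FPair FNil FNil.

Definition FRev : fn := FFold (FPair (FFst (FSnd FArg)) (FFst FArg)) FArg FNil FNil.

Definition FMap (body : fn) : fn :=
  FComp FRev (FFold (FPair (FComp body (FSnd FArg)) (FFst FArg))
                    (FFst FArg) FNil (FSnd FArg)).

Definition FZip : fn :=
  FComp FRev (FSnd (FFold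
    (FPair (FSnd (FFst (FFst FArg)))
           (FPair (FPair (FFst (FSnd FArg)) (FFst (FFst (FFst FArg))))
                  (FSnd (FFst FArg))))
    (FFst FArg) (FPair (FSnd FArg) FNil) FNil)).

(** The first list is only a unary counter, as no number can be computed and stored. *)
Definition FDrop : fn := FFold (FSnd (FFst FArg)) (FFst FArg) (FSnd FArg) FNil.

Definition FOr : fn :=
  FComp (FMap (FIf (FFst (FFst FArg)) FTrue (FSnd (FFst FArg)))) (FPair FZip FNil).

Definition FDiff : fn :=
  FComp (FMap (FIf (FSnd (FFst FArg)) FNil (FFst (FFst FArg)))) (FPair FZip FNil).

Definition FMeets : fn :=
  FFold (FIf (FFst FArg) FTrue
           (FIf (FFst (FFst (FSnd FArg))) (FSnd (FFst (FSnd FArg))) FNil))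
    FZip FNil FNil.

Section Arrays.
Variables (R : realFieldType) (orc : val R -> bool) (N : nat).
Local Notation ev := (feval orc N).

Definition tab (T : finType) (f : T -> val R) : val R := vlist [seq f x | x <- enum T].

Definition mask (T : finType) (A : {set T}) : val R := tab (fun x => vbool R (x \in A)).

Lemma spine_vlist (s : seq (val R)) : spine (vlist s) = s.
Proof. by elim: s => //= x s ->. Qed.

Lemma take_spine (s : seq (val R)) : (size s <= N)%N -> take N (spine (vlist s)) = s.
Proof. by move=> sN; rewrite spine_vlist take_oversize. Qed.

Lemma foldl_map (A B C : Type) (G : A -> B -> A) (f : C -> B) a s :
  foldl G a [seq f x | x <- s] = foldl (fun a x => G a (f x)) a s.
Proof. by elim: s a => //=. Qed.

Lemma take_spine_tab (T : finType) (f : T -> val R) :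
  (#|T| <= N)%N -> take N (spine (tab f)) = [seq f x | x <- enum T].
Proof. by move=> TN; rewrite take_spine // size_map -cardE. Qed.

(** Transfers an interpreted fold to a fold on sets and sequences, after which trees disappear from
    the argument. *)
Lemma foldl_morph (A B X : Type) (enc : A -> B) (F : B -> X -> B) (G : A -> X -> A) a s :
  (forall a x, F (enc a) x = enc (G a x)) -> foldl F (enc a) s = enc (foldl G a s).
Proof. by move=> FG; elim: s a => //= x s IH a; rewrite FG IH. Qed.

Lemma eq_tab (T : finType) (f g : T -> val R) : f =1 g -> tab f = tab g.
Proof. by move=> fg; rewrite /tab (eq_map fg). Qed.

Lemma vnums_tab (T : finType) (f : T -> R) :
  vnums [seq f x | x <- enum T] = tab (fun x => VNum (f x)).
Proof. by rewrite /vnums /tab -map_comp. Qed.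

Lemma truthy_vbool b : truthy (vbool R b) = b.
Proof. by case: b. Qed.

Lemma foldl_cons (A : Type) (X : Type) (f : X -> A) r s :
  foldl (fun acc x => f x :: acc) r s = rev [seq f x | x <- s] ++ r.
Proof. by elim: s r => //= x s IH r; rewrite IH rev_cons cat_rcons. Qed.

Lemma ev_rev s : (size s <= N)%N -> ev FRev (vlist s) = vlist (rev s).
Proof.
move=> sN; rewrite /= take_spine // -[VNil]/(vlist [::]).
rewrite (foldl_morph (enc := @vlist R) (G := fun acc x => x :: acc)) //.
by rewrite foldl_cons map_id cats0.
Qed.

Opaque FRev.

Lemma ev_map (X : Type) body (f : X -> val R) s c : (size s <= N)%N ->
  ev (FMap body) (VPair (vlist [seq f x | x <- s]) c) =
  vlist [seq ev body (VPair (f x) c) | x <- s].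
Proof.
move=> sN; rewrite /= take_spine ?size_map // -[VNil]/(vlist [::]).
rewrite foldl_map (foldl_morph (enc := @vlist R)
  (G := fun acc x => ev body (VPair (f x) c) :: acc)) // foldl_cons cats0.
by rewrite ev_rev ?revK // size_rev size_map.
Qed.

Lemma ev_map_tab (T : finType) body (f : T -> val R) c : (#|T| <= N)%N ->
  ev (FMap body) (VPair (tab f) c) = tab (fun x => ev body (VPair (f x) c)).
Proof. by move=> TN; rewrite /tab ev_map // -cardE. Qed.

Lemma ev_zip (X : Type) (f g : X -> val R) s : (size s <= N)%N ->
  ev FZip (VPair (vlist [seq f x | x <- s]) (vlist [seq g x | x <- s])) =
  vlist [seq VPair (f x) (g x) | x <- s].
Proof.
move=> sN; rewrite /= take_spine ?size_map // foldl_map.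
set F := (fun a => _).
suff FE acc : foldl F (VPair (vlist [seq g x | x <- s]) (vlist acc)) s =
    VPair VNil (vlist (rev [seq VPair (f x) (g x) | x <- s] ++ acc)).
  by rewrite (FE [::]) /= cats0 ev_rev ?revK // size_rev size_map.
elim: s acc {sN} => //= x s IH acc.
by rewrite -[F _ _]/(VPair (vlist [seq g x | x <- s])
  (vlist (VPair (f x) (g x) :: acc))) IH rev_cons cat_rcons.
Qed.

Lemma ev_zip_tab (T : finType) (f g : T -> val R) : (#|T| <= N)%N ->
  ev FZip (VPair (tab f) (tab g)) = tab (fun x => VPair (f x) (g x)).
Proof. by move=> TN; rewrite /tab ev_zip // -cardE. Qed.

Lemma ev_drop s t : (size s <= N)%N ->
  ev FDrop (VPair (vlist s) (vlist t)) = vlist (drop (size s) t).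
Proof.
move=> sN; rewrite /= take_spine //; elim: s t {sN} => [|x s IH] [|y t] //=.
by rewrite -[VNil]/(vlist [::]) IH.
Qed.

Opaque FMap FZip FDrop.

Section Masks.
Variable T : finType.
Hypothesis TN : (#|T| <= N)%N.
Implicit Types A B : {set T}.

Lemma ev_or A B : ev FOr (VPair (mask A) (mask B)) = mask (A :|: B).
Proof.
rewrite /= ev_zip_tab // ev_map_tab //; apply: eq_tab => x /=.
by rewrite truthy_vbool inE; case: (x \in A).
Qed.

Lemma ev_diff A B : ev FDiff (VPair (mask A) (mask B)) = mask (A :\: B).
Proof.
rewrite /= ev_zip_tab // ev_map_tab //; apply: eq_tab => x /=.
by rewrite truthy_vbool inE; case: (x \in B); case: (x \in A).
Qed.

Lemma ev_meets A B : ev FMeets (VPair (mask A) (mask B)) = vbool R (A :&: B != set0).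
Proof.
rewrite /= ev_zip_tab // take_spine_tab // foldl_map -[VNil]/(vbool R false).
rewrite (foldl_morph (enc := vbool R) (G := fun b x => b || (x \in A) && (x \in B))).
  congr vbool; have -> b s : foldl (fun b x => b || (x \in A) && (x \in B)) b s =
      b || has (mem (A :&: B)) s.
    elim: s b => [|x s IH] b /=; first by rewrite orbF.
    by rewrite IH inE orbA.
  apply/idP/idP => [/hasP[x _ xAB]|/set0Pn[x xAB]].
    by apply/set0Pn; exists x.
  by apply/hasP; exists x; rewrite ?mem_enum.
move=> b x /=; rewrite !truthy_vbool; case: b => //=; by case: (x \in A).
Qed.

Lemma mask_set0 : tab (fun _ : T => VNil) = mask (set0 : {set T}).
Proof. by apply: eq_tab => x; rewrite inE. Qed.

Lemma set_of_mask A : set_of T (mask A) = A.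
Proof.
apply/setP=> x; rewrite inE /mask /tab.
have -> : forall s : seq (val R), list_of (vlist s) = s by elim=> //= y s ->.
by rewrite (nth_map x) ?nth_enum_rank ?truthy_vbool // -cardE ltn_ord.
Qed.

End Masks.

Lemma vsumle11 a x y b : (1 < N)%N ->
  vsumle N (VPair (VNum a) VNil) (VNum x) (VNum y) (VPair (VNum b) VNil) =
  vbool R (a * x <= y * b).
Proof. by case: (N) => [|[|n]] // _; rewrite /vsumle /vsum /= !add0r. Qed.

Lemma vsumle12 a x y b c : (1 < N)%N ->
  vsumle N (VPair (VNum a) VNil) (VNum x) (VNum y)
           (VPair (VNum b) (VPair (VNum c) VNil)) =
  vbool R (a * x <= y * (b + c)).
Proof. by case: (N) => [|[|n]] // _; rewrite /vsumle /vsum /= !add0r ?take0. Qed.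

Lemma vsumle10 a x y : (1 < N)%N ->
  vsumle N (VPair (VNum a) VNil) (VNum x) (VNum y) VNil = vbool R (a * x <= 0).
Proof. by case: (N) => [|[|n]] // _; rewrite /vsumle /vsum /= !add0r ?mulr0. Qed.

Lemma vsumle_list s x y b : (1 < N)%N -> (size s <= N)%N ->
  vsumle N (vnums s) (VNum x) (VNum y) (VPair (VNum b) VNil) =
  vbool R ((\sum_(a <- s) a) * x <= y * b).
Proof.
move=> N1 sN; rewrite /vsumle /vsum take_spine ?size_map //.
have -> : take N (spine (VPair (VNum b) VNil)) = [:: VNum b] by case: (N) N1 => [|[|n]].
rewrite /= add0r foldl_map (foldl_morph (enc := @VNum R) (G := +%R)) //.
have -> : forall z, foldl +%R z s = z + \sum_(a <- s) a; last by rewrite add0r.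
by elim: s {sN} => [|a s IH] z; rewrite ?big_nil ?addr0 // big_cons /= IH addrA.
Qed.

End Arrays.
Opaque FRev FMap FZip FDrop FOr FDiff FMeets.
Arguments vsumle : simpl never.

(** * Greedy choice of representatives *)

Definition F1 (f : fn) : fn := FPair f FNil.

(* Among the unmarked entries of a list of pairs (mark, record), one whose
   record has the least first component. *)
Definition FPick : fn :=
  let acc := FFst FArg in let x := FFst (FSnd FArg) in
  FFold (FIf (FFst x) acc
          (FIf acc (FIf (FSumLe (F1 (FFst (FSnd x))) FOne FOne (F1 (FFst acc)))
                     (FSnd x) acc)
                   (FSnd x)))
    FArg FNil FNil.

Section Pick.
Variables (R : realFieldType) (orc : val R -> bool) (N : nat).
Local Notation ev := (feval orc N).
Variables (X : finType) (key : X -> R).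
Hypothesis N1 : (1 < N)%N.
Hypothesis XN : (#|X| <= N)%N.

Definition pick_step (cov : {set X}) (b : option X) (u : X) : option X :=
  if u \in cov then b
  else if b is Some v then (if key u <= key v then Some u else Some v) else Some u.

Definition pick_min (cov : {set X}) : option X := foldl (pick_step cov) None (enum X).

(** A record is a pair, hence truthy, so [VNil] can stand for [None]. *)
Lemma ev_pick (load : X -> val R) (cov : {set X}) :
  ev FPick (tab (fun u => VPair (vbool R (u \in cov)) (VPair (VNum (key u)) (load u)))) =
  if pick_min cov is Some v then VPair (VNum (key v)) (load v) else VNil.
Proof.
rewrite /= take_spine_tab // foldl_map /pick_min.
pose enc o := if o is Some v then VPair (VNum (key v)) (load v) else VNil : val R.
rewrite -[LHS]/(foldl _ (enc None) _) (foldl_morph (enc := enc) (G := pick_step cov)) //.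
move=> b u /=; rewrite truthy_vbool /pick_step; case: ifP => // _.
by case: b => [v|] //=; rewrite vsumle11 // mulr1 mul1r truthy_vbool; case: ifP.
Qed.

Lemma pick_minP cov :
  if pick_min cov is Some v
  then v \notin cov /\ forall u, u \notin cov -> key v <= key u
  else cov = setT.
Proof.
have H s : if foldl (pick_step cov) None s is Some v
  then v \notin cov /\ forall u, u \in s -> u \notin cov -> key v <= key u
  else forall u, u \in s -> u \in cov.
  elim/last_ind: s => [|s x] //; rewrite -cats1 foldl_cat /=.
  case: foldl => [v [vc vm]|A]; rewrite /pick_step; case: ifP => [xc|/negbT xc].
  - split=> // u; rewrite mem_cat inE => /orP[/vm//|/eqP->]; by rewrite xc.
  - case: leP => kxv; split=> // u; rewrite mem_cat inE => /orP[us uc|/eqP->//].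
    + exact: le_trans kxv (vm _ us uc).
    + exact: vm.
    + by move=> _; exact: ltW.
  - by move=> u; rewrite mem_cat inE => /orP[/A//|/eqP->].
  - split=> // u; rewrite mem_cat inE => /orP[/A->//|/eqP->//].
have := H (enum X); rewrite -/(pick_min cov); case: pick_min => [v [vc vm]|A].
  by split=> // u; apply: vm; rewrite mem_enum.
by apply/setP=> u; rewrite inE A // mem_enum.
Qed.

End Pick.
Opaque FPick.

(* A client is a triple: radius, distances to facilities, distances to clients. *)
Definition c_radius (f : fn) : fn := FFst f.
Definition c_facs (f : fn) : fn := FFst (FSnd f).
Definition c_clients (f : fn) : fn := FSnd (FSnd f).

(* Arguments and results are nested pairs, whose shape is given above each function. *)

(* (best, ((marked clients, balls), (d0, r0))) -> (marked clients, balls) *)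
Definition FRound2 : fn :=
  let best := FFst FArg in let marked := FFst (FFst (FSnd FArg)) in
  let balls := FSnd (FFst (FSnd FArg)) in
  let ctx := FPair (c_radius best) (FSnd (FSnd FArg)) in
  let rb := FFst (FSnd FArg) in
  let d0 := FFst (FSnd (FSnd FArg)) in let r0 := FSnd (FSnd (FSnd FArg)) in
  let d := FFst (FFst FArg) in let flag := FFst (FSnd (FFst FArg)) in
  let rec := FSnd (FSnd (FFst FArg)) in
  FIf best
    (FPair
      (FComp (FMap (FPair (FIf flag FTrue
                            (FSumLe (F1 d) r0 d0 (FPair (c_radius rec) (F1 rb)))) rec))
             (FPair (FComp FZip (FPair (c_clients best) marked)) ctx))
      (FPair (FComp (FMap (FSumLe (F1 (FFst FArg)) r0 d0 (F1 rb)))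
                    (FPair (c_facs best) ctx))
             balls))
    (FFst (FSnd FArg)).

Definition FRound : fn :=
  FComp FRound2 (FPair (FComp FPick (FFst (FFst FArg))) FArg).

(* (clients, (d0, r0)) -> balls *)
Definition FGreedy : fn :=
  FSnd (FFold (FComp FRound (FPair (FFst FArg) (FSnd (FSnd FArg))))
         (FFst FArg)
         (FPair (FComp (FMap (FPair FNil (FFst FArg))) (FPair (FFst FArg) FNil)) FNil)
         (FSnd FArg)).

(* (result, (best, (d0, r0))) -> best *)
Definition FUpd : fn :=
  let best := FFst (FSnd FArg) in let ctx := FSnd (FSnd FArg) in
  let new := FPair (FFst (FFst FArg)) ctx in
  FIf (FFst FArg)
    (FIf best
       (FIf (FSumLe (F1 (FFst ctx)) (FSnd (FSnd best)) (FFst (FSnd best)) (F1 (FSnd ctx)))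
            new best)
       new)
    best.

(* (best, (d0, (r0, (clients, extra)))) -> best *)
Definition FTry (sel : fn) : fn :=
  let d0 := FFst (FSnd FArg) in let r0 := FFst (FSnd (FSnd FArg)) in
  let clients := FFst (FSnd (FSnd (FSnd FArg))) in
  let extra := FSnd (FSnd (FSnd (FSnd FArg))) in
  FComp FUpd
    (FPair (FComp sel (FPair (FComp FGreedy (FPair clients (FPair d0 r0))) extra))
           (FPair (FFst FArg) (FPair d0 r0))).

(* (clients, extra) -> solution *)
Definition FSolve (sel : fn) : fn :=
  let rec := FFst (FSnd FArg) in
  FFst (FFold
    (FFold (FTry sel) (c_facs rec) (FFst FArg) (FPair (c_radius rec) (FSnd (FSnd FArg))))
    (FFst FArg) FNil FArg).

Section Solve.
Variables (R : realFieldType) (orc : val R -> bool) (N : nat).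
Local Notation ev := (feval orc N).
Variables (V T : finType) (dT : V -> T -> R) (dV : V -> V -> R) (r : V -> R).
Hypothesis N1 : (1 < N)%N.
Hypothesis VN : (#|V| <= N)%N.
Hypothesis TN : (#|T| <= N)%N.

Definition client (v : V) : val R :=
  VPair (VNum (r v)) (VPair (tab (fun f => VNum (dT v f))) (tab (fun u => VNum (dV v u)))).

Definition marked (cov : {set V}) : val R :=
  tab (fun u => VPair (vbool R (u \in cov)) (client u)).

Lemma ev_pick_client cov :
  ev FPick (marked cov) = if pick_min r cov is Some v then client v else VNil.
Proof. exact: ev_pick. Qed.

Section Guess.
Variables d0 r0 : R.

(** The guess is [rho = d0 / r0]; both conditions are multiplied through by [r0]. *)
Definition near (v : V) : {set V} := [set u | dV v u * r0 <= d0 * (r u + r v)].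
Definition ball (v : V) : {set T} := [set f | dT v f * r0 <= d0 * r v].

Definition round (s : {set V} * seq V) : {set V} * seq V :=
  if pick_min r s.1 is Some v then (s.1 :|: near v, v :: s.2) else s.

Definition enc_state (s : {set V} * seq V) : val R :=
  VPair (marked s.1) (vlist [seq mask R (ball v) | v <- s.2]).

Lemma ev_round s : ev FRound (VPair (enc_state s) (VPair (VNum d0) (VNum r0))) =
  enc_state (round s).
Proof.
rewrite /= ev_pick_client /round; case: pick_min => [v|] //=.
rewrite /marked ev_zip_tab // !ev_map_tab //; congr (VPair _ (VPair _ _)).
  apply: eq_tab => u /=; rewrite truthy_vbool vsumle12 // !inE.
  by case: (u \in _).
by apply: eq_tab => f /=; rewrite vsumle11 // inE.
Qed.

(** [enum V] is only a clock: a round marks at least its own pick, so [#|V|] rounds exhaust the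
    clients and any further one is idle. *)
Definition greedy : seq V := (foldl (fun s _ => round s) (set0, [::]) (enum V)).2.

Lemma ev_greedy : ev FGreedy (VPair (tab client) (VPair (VNum d0) (VNum r0))) =
  vlist [seq mask R (ball v) | v <- greedy].
Proof.
Opaque FRound.
rewrite /= take_spine_tab // foldl_map ev_map_tab //=.
have -> : VPair (tab (fun x => VPair VNil (client x))) VNil = enc_state (set0, [::]).
  by congr VPair; apply: eq_tab => u; rewrite inE.
rewrite (foldl_morph (enc := enc_state) (G := fun s _ => round s)) // => s u.
exact: ev_round.
Qed.

Hypothesis d0_ge0 : 0 <= d0.
Hypothesis r0_gt0 : 0 < r0.
Hypothesis r_gt0 : forall v, 0 < r v.
Hypothesis dV_self : forall v, dV v v = 0.
Hypothesis dV_sym : forall u v, dV u v = dV v u.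
Hypothesis dVT : forall u v f, dV u v <= dT u f + dT v f.
Hypothesis dTV : forall u v f, dT u f <= dV u v + dT v f.

(** Ensures that later folds over the balls are not truncated by the fuel. *)
Lemma size_greedy : (size greedy <= #|V|)%N.
Proof.
rewrite /greedy cardE; set s0 := (_, _).
have H s : (size (foldl (fun s (_ : V) => round s) s0 s).2 <= size s)%N.
  elim/last_ind: s => // s x IH; rewrite -cats1 foldl_cat /= size_cat addn1.
  by rewrite /round; case: pick_min => //= *; exact: leqW.
exact: H.
Qed.

Lemma greedyP :
  pairwise (fun A B : {set T} => [disjoint A & B]) [seq ball v | v <- greedy] /\
  forall u, exists v, [/\ v \in greedy, r v <= r u & u \in near v].
Proof.
(* The third clause keeps the next pick far from all earlier representatives. The fourth counts the
   marked clients, at least one per round. *)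
pose inv (s : {set V} * seq V) (n : nat) :=
  [/\ pairwise (fun A B : {set T} => [disjoint A & B]) [seq ball v | v <- s.2],
   forall u, u \in s.1 -> exists v, [/\ v \in s.2, r v <= r u & u \in near v],
   forall v, v \in s.2 -> near v \subset s.1
   & s.1 = setT \/ (n <= #|s.1|)%N].
have H s : inv (foldl (fun s (_ : V) => round s) (set0, [::]) s) (size s).
  elim/last_ind: s => [|s x].
    by split=> //= [u|]; rewrite ?inE //; right.
  rewrite -cats1 foldl_cat size_cat addn1 /=; set st := foldl _ _ _.
  move=> [A1 A2 A3 A4]; rewrite /round.
  have := pick_minP r st.1; case: pick_min => [v [vc vmin]|full]; last first.
    by split=> //; left.
  have vv : v \in near v.
    by rewrite inE dV_self mul0r mulr_ge0 // ltW // addr_gt0.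
  split=> /=.
  (* A common point of [ball v] and [ball w] would put [v] in [near w] by the triangle inequality,
     but [near w] is already marked and [v] is not. *)
  - rewrite A1 andbT all_map; apply/allP => w ws /=.
    rewrite disjoints_subset; apply/subsetP => f; rewrite !inE => fv.
    apply: contra vc => fw; apply: (subsetP (A3 _ ws)); rewrite inE dV_sym.
    have := ler_wpM2r (ltW r0_gt0) (dVT v w f); rewrite mulrDl => /le_trans; apply.
    by rewrite mulrDr; apply: lerD.
  - move=> u; rewrite inE; case uc: (u \in st.1) => /= un.
      by have [w [ws rw nw]] := A2 _ uc; exists w; rewrite inE ws orbT.
    by exists v; rewrite inE eqxx vmin ?uc.
  - move=> w; rewrite inE => /orP[/eqP->|/A3 ws]; first exact: subsetUr.
    exact: subset_trans ws (subsetUl _ _).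
  - right; case: A4 => [full|A4]; first by rewrite full inE in vc.
    apply: leq_ltn_trans A4 (proper_card _).
    apply/properP; split; first exact: subsetUl.
    by exists v; rewrite // inE vv orbT.
have [A1 A2 _ A4] := H (enum V); split=> // u; apply: A2.
case: A4 => [->|]; first by rewrite inE.
rewrite -cardE; set st := (foldl _ _ _).1 => cV.
have -> : st = setT by apply/eqP; rewrite eqEcard subsetT cardsT.
by rewrite inE.
Qed.

(* The representative [v] of [u] has [r v <= r u], so
   [dT u f <= dV u v + dT v f <= rho (r u + r v) + rho (r v) <= 3 rho (r u)]. *)
Lemma hitting_covers (S : {set T}) :
  (forall v, v \in greedy -> S :&: ball v != set0) ->
  forall u, exists2 f, f \in S & dT u f * r0 <= 3 * d0 * r u.
Proof.
move=> hit u; have [v [vg rvu nu]] := greedyP.2 u.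
have /set0Pn[f] := hit _ vg; rewrite !inE => /andP[fS fv]; exists f => //.
have := ler_wpM2r (ltW r0_gt0) (dTV u v f); rewrite mulrDl => /le_trans; apply.
move: nu; rewrite inE dV_sym => nu.
have := ler_wpM2l d0_ge0 rvu; rewrite mulrDr in nu; lra.
Qed.

End Guess.

(** * Search over the guessed ratios *)

Hypothesis dT_ge0 : forall v f, 0 <= dT v f.
Hypothesis r_gt0 : forall v, 0 < r v.
Hypothesis dV_self : forall v, dV v v = 0.
Hypothesis dV_sym : forall u v, dV u v = dV v u.
Hypothesis dVT : forall u v f, dV u v <= dT u f + dT v f.
Hypothesis dTV : forall u v f, dT u f <= dV u v + dT v f.

Variables (sel : fn) (extra : val R) (feas : {set T} -> bool).

Definition hits (S : {set T}) (bs : seq {set T}) : Prop :=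
  forall b, b \in bs -> S :&: b != set0.

(** Failure has to be conclusive, since the search infers from it that the guess is too small. The
    solution is wrapped in a pair because a mask over an empty type is [VNil], the sign of
    failure. *)
Definition selects (bs : seq {set T}) (w : val R) : Prop :=
  (exists S, [/\ w = VPair (mask R S) VNil, feas S & hits S bs]) \/
  (w = VNil /\ forall S, feas S -> ~ hits S bs).

Hypothesis selP : forall bs : seq {set T}, (size bs <= N)%N ->
  pairwise (fun A B : {set T} => [disjoint A & B]) bs ->
  selects bs (ev sel (VPair (vlist [seq mask R b | b <- bs]) extra)).

Definition covered (S : {set T}) (d0 r0 : R) : Prop :=
  forall u, exists2 f, f \in S & dT u f * r0 <= d0 * r u.

Definition valid_best (w : val R) : Prop :=
  w = VNil \/ exists S d0 r0, [/\ w = VPair (mask R S) (VPair (VNum d0) (VNum r0)),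
    feas S, 0 < r0 & covered S (3 * d0) r0].

(** The recorded guess [d0 / r0] is at most [dT v f / r v], claimed only when some feasible set
    attains the latter ratio. *)
Definition beats (v : V) (f : T) (w : val R) : Prop :=
  (exists2 S, feas S & covered S (dT v f) (r v)) ->
  exists (S : {set T}) d0 r0, w = VPair (mask R S) (VPair (VNum d0) (VNum r0)) /\
    d0 * r v <= dT v f * r0.

Lemma ev_upd (S S1 : {set T}) d r' d1 r1 :
  let w1 := VPair (mask R S1) (VPair (VNum d1) (VNum r1)) in
  ev FUpd (VPair (VPair (mask R S) VNil) (VPair w1 (VPair (VNum d) (VNum r')))) =
  if d * r1 <= d1 * r' then VPair (mask R S) (VPair (VNum d) (VNum r')) else w1.
Proof. by rewrite /= vsumle11 // truthy_vbool. Qed.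

Lemma try_step w v f : valid_best w ->
  let w' := ev (FTry sel) (VPair w (VPair (VNum (dT v f))
     (VPair (VNum (r v)) (VPair (tab client) extra)))) in
  [/\ valid_best w', beats v f w'
   & forall v' f', beats v' f' w -> beats v' f' w'].
Proof.
Opaque FGreedy FUpd.
move=> vw; rewrite /= ev_greedy; set g := greedy _ _.
have [disj cov] := greedyP (dT_ge0 v f) (r_gt0 v) r_gt0 dV_self dV_sym dVT.
have sg : (size g <= N)%N by apply: leq_trans (size_greedy _ _) VN.
have := @selP [seq ball (dT v f) (r v) u | u <- g]; rewrite size_map -map_comp.
move=> /(_ sg disj); set res := ev sel _.
pose new (S : {set T}) := VPair (mask R S) (VPair (VNum (dT v f)) (VNum (r v))).
case=> [[S [-> fS hS]]|[-> nS]]; last first.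
  have -> : ev FUpd (VPair VNil (VPair w (VPair (VNum (dT v f)) (VNum (r v))))) = w by [].
  (* A feasible set attaining the guess would meet every ball, contrary to the failure of [sel]. *)
  split=> // -[S fS cS]; case: (nS _ fS) => b /mapP[u ug ->].
  have [s sS us] := cS u; apply/set0Pn; exists s; by rewrite !inE sS.
have covS : covered S (3 * dT v f) (r v).
  by apply: hitting_covers => // u ug; apply: hS; exact: map_f.
have vnew : valid_best (new S) by right; exists S, (dT v f), (r v).
have bnew : beats v f (new S) by exists S, (dT v f), (r v).
case: (vw) => [->|[S1 [d1 [r1 [ew fS1 r1_gt0 cS1]]]]].
  have -> : ev FUpd (VPair (VPair (mask R S) VNil)
     (VPair VNil (VPair (VNum (dT v f)) (VNum (r v))))) = new S by [].
  by split=> // v' f' b /b [S2 [d2 [r2 []]]].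
have -> : ev FUpd (VPair (VPair (mask R S) VNil)
     (VPair w (VPair (VNum (dT v f)) (VNum (r v))))) =
   if dT v f * r1 <= d1 * r v then new S else w.
  by rewrite ew ev_upd.
case: leP => cmp; last first.
  by split=> // _; exists S1, d1, r1; split=> //; exact: ltW.
split=> // v' f' b /b [S2 [d2 [r2 []]]]; rewrite ew => -[_ <- <-] cmp2.
exists S, (dT v f), (r v); split=> //.
have rv := r_gt0 v; have rv' := r_gt0 v'.
(* Transitivity of the order on fractions: multiply by the middle denominator [r1]. *)
rewrite -(ler_pM2r r1_gt0).
have := ler_wpM2r (ltW rv') cmp; have := ler_wpM2r (ltW rv) cmp2; lra.
Qed.

(** Abstract because it is used twice: for the fold over facilities, and for the fold over clients
    whose step is that inner fold. Since [seen] persists, each query needs to be settled only at its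
    own item. *)
Lemma foldl_search (A X : Type) (F : A -> X -> A) (valid : A -> Prop)
    (Q : Type) (seen : Q -> A -> Prop) (new : X -> Q -> Prop) s a :
  valid a ->
  (forall a x, valid a -> [/\ valid (F a x), forall q, new x q -> seen q (F a x)
     & forall q, seen q a -> seen q (F a x)]) ->
  [/\ valid (foldl F a s),
      forall q, List.Exists (fun x => new x q) s -> seen q (foldl F a s)
    & forall q, seen q a -> seen q (foldl F a s)].
Proof.
move=> va step; elim: s a va => [|x s IH] a va /=.
  by split=> // q /List.Exists_nil.
have [v1 n1 k1] := step a x va; have [v2 n2 k2] := IH _ v1; split=> // q.
  by move=> /List.Exists_cons[/n1/k2|/n2].
by move=> /k1/k2.
Qed.

Lemma solveP : feas set0 ->
  let S := set_of T (ev (FSolve sel) (VPair (tab client) extra)) in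
  feas S /\ forall v f,
    (exists2 S', feas S' & covered S' (dT v f) (r v)) -> covered S (3 * dT v f) (r v).
Proof.
Opaque FTry.
move=> f0; rewrite /= take_spine_tab // foldl_map.
set w := foldl _ _ _.
have in_Exists (X : eqType) (P : X -> Prop) s x : x \in s -> P x -> List.Exists P s.
  elim: s => // y s IH; rewrite inE => /orP[/eqP->|/IH{}IH] Px.
    exact: List.Exists_cons_hd.
  by apply: List.Exists_cons_tl; exact: IH.
have [vw bw] : valid_best w /\ forall v f, beats v f w.
  have [|a v va|vw bw _] := @foldl_search _ _
     (fun a v => ev (FFold (FTry sel) (c_facs (FFst (FSnd FArg))) (FFst FArg)
       (FPair (c_radius (FFst (FSnd FArg))) (FSnd (FSnd FArg))))
       (VPair a (VPair (client v) (VPair (tab client) extra))))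
     valid_best _ (fun q : V * T => beats q.1 q.2) (fun v q => v = q.1) (enum V) VNil.
  - by left.
  - rewrite /= take_spine_tab // foldl_map.
    have [b f vb|v1 b1 k1] := @foldl_search _ _ (fun b f => ev (FTry sel)
      (VPair b (VPair (VNum (dT v f)) (VPair (VNum (r v)) (VPair (tab client) extra)))))
      valid_best _ (fun q : V * T => beats q.1 q.2) (fun f q => (v, f) = q) (enum T) a va.
    + have [v1 b1 k1] := try_step v f vb; split=> //.
        by move=> q <-.
      by move=> q; exact: k1.
    + split=> // -[v' f'] /= <-; apply: (b1 (v, f')).
      by apply: (in_Exists _ _ _ f'); rewrite ?mem_enum.
  - split=> // v f; apply: (bw (v, f)).
    by apply: (in_Exists _ _ _ v); rewrite ?mem_enum.
(* If no guess succeeded, [VNil] decodes to [set0], and [beats] shows that no guess was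
   attainable. *)
case: vw => [w0|[S [d0 [r0 [ew fS r0_gt0 cS]]]]].
  have -> : set_of T (fstv w) = set0.
    by rewrite w0; apply/setP=> x; rewrite !inE /= nth_nil.
  by split=> // v f /bw[S [d [q []]]]; rewrite w0.
rewrite ew /= set_of_mask; split=> // v f /bw[S2 [d2 [r2 []]]].
rewrite ew => -[_ <- <-] cmp u; have [s sS us] := cS u; exists s => //.
rewrite -(ler_pM2r r0_gt0).
have := ler_wpM2r (ltW (r_gt0 u)) cmp; have := ler_wpM2r (ltW (r_gt0 v)) us; lra.
Qed.

End Solve.

(** * Knapsack constraints *)

(* (best, (S, weights)) -> (S, weights) *)
Definition FKAdd : fn :=
  FIf (FFst FArg)
    (FPair (FComp FOr (FPair (FFst (FSnd FArg)) (FSnd (FFst FArg))))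
           (FPair (FFst (FFst FArg)) (FSnd (FSnd FArg))))
    FNil.

(* ((S, weights), (ball, facilities)) -> (S, weights) *)
Definition FKStep : fn :=
  FIf (FFst FArg)
    (FComp FKAdd
      (FPair (FComp FPick (FComp FZip
               (FPair (FComp (FMap (FIf (FFst FArg) FNil FTrue))
                             (FPair (FFst (FSnd FArg)) FNil))
                      (FSnd (FSnd FArg)))))
             (FFst FArg)))
    FNil.

(* ((S, weights), B) -> (S, nil) *)
Definition FKEnd : fn :=
  FIf (FFst FArg)
    (FIf (FSumLe (FSnd (FFst FArg)) FOne FOne (F1 (FSnd FArg)))
         (FPair (FFst (FFst FArg)) FNil) FNil)
    FNil.

(* (balls, (facilities, B)) -> (S, nil) *)
Definition FKnap : fn :=
  FComp FKEnd
    (FPair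
      (FFold FKStep (FFst FArg)
        (FPair (FComp (FMap FNil) (FPair (FFst (FSnd FArg)) FNil)) FNil)
        (FFst (FSnd FArg)))
      (FSnd (FSnd FArg))).

Section Knapsack.
Variables (R : realFieldType) (orc : val R -> bool) (N : nat).
Local Notation ev := (feval orc N).
Variables (T : finType) (w : T -> R) (B : R).
Hypothesis N1 : (1 < N)%N.
Hypothesis TN : (#|T| <= N)%N.
Hypothesis w_ge0 : forall f, 0 <= w f.

Definition facility (f : T) : val R := VPair (VNum (w f)) (mask R [set f]).

(** [pick_min] avoids a marked set, so marking the complement of [b] yields a cheapest point of [b],
    or nothing if [b] is empty. The picks are kept as a list because their total weight cannot be
    stored. *)
Definition kstep (o : option ({set T} * seq T)) (b : {set T}) :=
  if o is Some (A, l) then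
    if pick_min w (~: b) is Some f then Some (A :|: [set f], f :: l) else None
  else None.

Definition kenc (o : option ({set T} * seq T)) : val R :=
  if o is Some (A, l) then VPair (mask R A) (vnums [seq w f | f <- l]) else VNil.

Lemma ev_kstep o b :
  ev FKStep (VPair (kenc o) (VPair (mask R b) (tab facility))) = kenc (kstep o b).
Proof.
case: o => [[S l]|] //=; rewrite ev_map_tab // ev_zip_tab //=.
rewrite (eq_tab (g := fun u => VPair (vbool R (u \in ~: b)) (facility u))); last first.
  by move=> u; rewrite truthy_vbool inE; case: (u \in b).
rewrite (@ev_pick _ orc N _ w) //; case: pick_min => [f|] //=.
by rewrite ev_or.
Qed.

(** The list counts a pick once per ball, so its sum bounds the weight of [A] from above;
    minimality, ball by ball, bounds that sum by the weights of [S'] inside the balls. Disjointness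
    enters afterwards through [sum_disjoint]. *)
Lemma kstepP bs :
  if foldl kstep (Some (set0, [::])) bs is Some (A, l) then
    [/\ size l = size bs, hits A bs, \sum_(f in A) w f <= \sum_(f <- l) w f
     & forall S', hits S' bs ->
        \sum_(f <- l) w f <= \sum_(b <- bs) \sum_(f in S' :&: b) w f]
  else forall S', ~ hits S' bs.
Proof.
elim/last_ind: bs => [|bs b].
  by split=> //; rewrite ?big_set0 ?big_nil // => S' _; rewrite !big_nil.
rewrite -cats1 foldl_cat /=; case: foldl => [[S l] [A1 A2 A3 A4]|A] /=; last first.
  by move=> S' hS; apply: (A S') => b' b's; apply: hS; rewrite mem_cat b's.
have := pick_minP w (~: b); case: pick_min => [f [fb fmin]|b0]; last first.
  move=> S' /(_ b); rewrite mem_cat inE eqxx orbT => /(_ isT).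
  by rewrite -(setCK b) b0 setCT setI0 eqxx.
rewrite inE negbK in fb; split.
- by rewrite size_cat /= A1 addn1.
- move=> b'; rewrite mem_cat inE => /orP[/A2/set0Pn[g]|/eqP->].
    by rewrite inE => /andP[gS gb]; apply/set0Pn; exists g; rewrite !inE gS gb.
  by apply/set0Pn; exists f; rewrite !inE eqxx orbT.
- rewrite big_cons; case fS: (f \in S).
    have -> : S :|: [set f] = S by apply/setUidPl; rewrite sub1set.
    by apply: le_trans A3 _; rewrite lerDr.
  by rewrite setUC big_setU1 ?fS //= lerD2l.
- move=> S' hS; rewrite big_cons big_cat /= big_seq1 addrC; apply: lerD; last first.
    by apply: A4 => b' b's; apply: hS; rewrite mem_cat b's.
  have /set0Pn[g gSb] : S' :&: b != set0 by apply: hS; rewrite mem_cat inE eqxx orbT.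
  rewrite (bigD1 g) //=; apply: le_trans (_ : w g <= _).
    by apply: fmin; rewrite inE negbK; move: gSb; rewrite inE => /andP[].
  by rewrite lerDl sumr_ge0.
Qed.

Lemma sum_disjoint (bs : seq {set T}) (S : {set T}) :
  pairwise (fun A B : {set T} => [disjoint A & B]) bs ->
  \sum_(b <- bs) \sum_(f in S :&: b) w f <= \sum_(f in S) w f.
Proof.
elim: bs S => [|b bs IH] S /=; first by rewrite big_nil sumr_ge0.
move=> /andP[/allP db dbs]; rewrite big_cons [leRHS](big_setID b) /=.
rewrite lerD2l; apply: le_trans (IH (S :\: b) dbs).
rewrite le_eqVlt; apply/orP; left; apply/eqP; apply: eq_big_seq => b' b's.
apply: eq_bigl => f; rewrite !inE.
case fb: (f \in b) => //=; have := db _ b's; rewrite disjoint_sym.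
by move=> /disjointFl-> //; rewrite andbF.
Qed.

Lemma knapP bs : (size bs <= N)%N ->
  pairwise (fun A B : {set T} => [disjoint A & B]) bs ->
  selects (fun S : {set T} => \sum_(u in S) w u <= B) bs
    (ev FKnap (VPair (vlist [seq mask R b | b <- bs]) (VPair (tab facility) (VNum B)))).
Proof.
Opaque FKStep.
move=> sN disj; rewrite /= take_spine ?size_map // ev_map_tab //= foldl_map mask_set0.
rewrite -[VPair (mask R set0) VNil]/(kenc (Some (set0, [::]))).
rewrite (foldl_morph (enc := kenc) (G := kstep)); last exact: ev_kstep.
have := kstepP bs; case: foldl => [[S l] [A1 A2 A3 A4]|A] /=; last first.
  by right; split=> // S _; exact: A.
rewrite vsumle_list ?size_map ?A1 // mulr1 mul1r truthy_vbool big_map.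
case: leP => cmp; [left|right].
  by exists S; split=> //; exact: le_trans A3 cmp.
split=> // S' fS' hS'; have := lt_le_trans cmp (A4 _ hS').
by move/lt_le_trans => /(_ _ (sum_disjoint S' disj)); rewrite ltNge fS'.
Qed.

End Knapsack.

(** * Augmenting paths for matroids *)

Section Augmentation.
Local Open Scope nat_scope.
Variables (T : finType) (M : matroid T).
Implicit Types (A I S : {set T}) (x y z : T) (p q : seq T).
Local Notation ind A := (A \in indep M).

Lemma indep_extend A I : ind A -> ind I ->
  exists A', [/\ A \subset A', A' \subset A :|: I, ind A' & #|I| <= #|A'|].
Proof.
move: {2}(#|I| - #|A|) (leqnn (#|I| - #|A|)) => n.
elim: n A => [|n IH] A nA iA iI.
  by exists A; split=> //; [exact: subsetUl | rewrite -subn_eq0 -leqn0].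
case: (leqP #|I| #|A|) => [IA|AI]; first by exists A; split=> //; exact: subsetUl.
have [x] := indep_exchange iA iI AI; rewrite inE => /andP[xA xI] ixA.
have [|//|//|A' [s1 s2 iA' c]] := IH (x |: A).
  rewrite cardsU1 xA; lia.
exists A'; split=> //; first exact: subset_trans (subsetUr _ _) s1.
apply: subset_trans s2 _; rewrite setUC setUA -setUA setUC -setUA.
by rewrite subUset sub1set !inE xI orbT /= subUset subsetUl subsetUr.
Qed.

(* Both sides say that [x] is not in the common span of [A] and [A']. *)
Lemma indep_swap A A' z x : ind A -> ind A' -> #|A| = #|A'| ->
  A' \subset z |: A -> ~~ ind (z |: A) -> x \notin A -> x \notin A' ->
  ind (x |: A') = ind (x |: A).
Proof.
move=> iA iA' cA sA dz xA xA'; apply/idP/idP => ix.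
  have [|e] := indep_exchange iA ix; first by rewrite cardsU1 xA' cA.
  rewrite !inE => /andP[eA /orP[/eqP->//|eA']] ie.
  move: (subsetP sA _ eA'); rewrite !inE (negPf eA) orbF => /eqP ez.
  by rewrite ez (negPf dz) in ie.
have [|e] := indep_exchange iA' ix; first by rewrite cardsU1 xA cA.
rewrite !inE => /andP[eA' /orP[/eqP->//|eA]] ie.
have /eqP eq : e |: A' == z |: A.
  rewrite eqEcard subUset sub1set !inE eA orbT sA /=.
  by rewrite !cardsU1 eA' cA leq_add2r leq_b1.
by rewrite eq (negPf dz) in ie.
Qed.

Variable ball : T -> {set T}.
Hypothesis ballP : forall x y, y \in ball x -> ball y = ball x.

(** Common independence in [M] and in the partition matroid whose blocks are the balls, one point
    per block. A point in no block is recognised by [x \notin ball x]. *)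
Definition good I : Prop :=
  [/\ ind I, forall x, x \in I -> x \in ball x
    & forall x y, x \in I -> y \in I -> y \in ball x -> y = x].

Definition used I x : bool := I :&: ball x != set0.

(** The head [x] of [p] enters and pushes out the point of [I] in its block; the next point of the
    path has to extend what remains. An empty path means a source, which extends [I] itself. *)
Definition base I p : {set T} := if p is x :: _ then I :\: ball x else I.

Fixpoint no_shortcut I z p : Prop :=
  if p is _ :: q then ~~ ind (z |: base I q) /\ no_shortcut I z q else True.

(* An augmenting path, listed from its end to its source. *)
Fixpoint augpath I p : Prop :=
  if p is x :: q then
    [/\ x \notin I, x \in ball x & ind (x |: base I q)] /\
    [/\ no_shortcut I x q, all (used I) q & augpath I q]
  else True.

Definition augment I p : {set T} :=
  foldl (fun J x => (J :\: ball x) :|: [set x]) I p.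

Lemma ball_eq x y u : u \in ball x -> u \in ball y -> ball x = ball y.
Proof. by move=> /ballP <- /ballP <-. Qed.

Section Peel.
Variables (I : {set T}) (x x' : T) (r : seq T).
Hypothesis gI : good I.
Hypothesis pI : augpath I [:: x, x' & r].
Hypothesis fx : ~~ used I x.

Let J : {set T} := x |: (I :\: ball x').

Let xI : x \notin I. Proof. by case: pI => -[]. Qed.
Let xbx : x \in ball x. Proof. by case: pI => -[]. Qed.
Let ux' : used I x'. Proof. by case: pI => _ [] _ /= /andP[]. Qed.
Let iJ : ind J. Proof. by case: pI => -[]. Qed.
Let x_far y : used I y -> x \notin ball y.
Proof. by move=> uy; apply: contra fx => /ballP xy; rewrite /used xy. Qed.

Let card_J : #|J| = #|I|.
Proof.
rewrite cardsU1 inE (negPf xI) andbF /= cardsD.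
have /set0Pn[y] := ux'; rewrite inE => /andP[yI yb].
have -> : I :&: ball x' = [set y].
  apply/setP=> u; rewrite !inE; apply/andP/eqP => [[uI ub]|->//].
  have [_ _ un] := gI; apply: un => //.
  by rewrite (ballP yb).
have : 0 < #|I| by rewrite (cardD1 y) yI.
by rewrite cards1; lia.
Qed.

(** Only the blocks of [x] and [x'] change between [I] and [J]. The first is free, hence not that of
    [y]; the second is excluded because [x] extends [I :\: ball x']. *)
Let meet_J y : used I y -> ~~ ind (x |: (I :\: ball y)) -> J :&: ball y = I :&: ball y.
Proof.
move=> uy dy; apply/setP=> u; rewrite !inE.
case: (eqVneq u x) => [->|ux] /=; first by rewrite (negPf (x_far uy)) andbF.
case uy': (u \in ball y); rewrite ?andbF // !andbT.
case ux'b: (u \in ball x') => //=; case: (negP dy).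
by rewrite -(ball_eq ux'b uy').
Qed.

Let base_J z q : z \notin I -> z != x -> all (used I) q -> ~~ ind (x |: base I q) ->
  ind (z |: base J q) = ind (z |: base I q).
Proof.
have [iI _ _] := gI.
move=> zI zx uq dq; apply: (@indep_swap _ _ x) => //.
- by case: q {uq dq} => //= y q; apply: indep_sub iI; exact: subsetDl.
- by case: q {uq dq} => //= y q; apply: indep_sub iJ; exact: subsetDl.
- case: q uq dq => [|y q] //= /andP[uy _] dy.
  by rewrite !cardsD (meet_J uy dy) card_J.
- case: q {uq dq} => [|y q] /=; first by rewrite setUS // subsetDl.
  by apply/subsetP=> u; rewrite !inE => /andP[-> /=]; case: eqP => //= _ /andP[].
- by case: q {uq dq} => //= y q; rewrite inE (negPf zI) andbF.
- by case: q {uq dq} => [|y q] /=; rewrite !inE (negPf zI) (negPf zx) ?andbF.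
Qed.

Let no_shortcut_J z q : z \notin I -> z != x -> no_shortcut I x q ->
  all (used I) q -> no_shortcut I z q -> no_shortcut J z q.
Proof.
move=> zI zx; elim: q => //= y q IH [dx nx] /andP[uy uq] [dz nz].
by split; [rewrite base_J | exact: IH].
Qed.

Let augpath_J q : augpath I q -> no_shortcut I x q -> all (used I) q -> augpath J q.
Proof.
elim: q => //= z q IH [[zI zb iz] [nz uq aq]] [dx nx] /andP[uz _].
have zx : z != x by apply: contraNneq fx => <-.
split; split=> //.
- by rewrite !inE (negPf zI) (negPf zx) andbF.
- by rewrite base_J.
- exact: no_shortcut_J.
- elim: q dx nx uq {IH iz nz aq} => //= y q IH dx [dy ny] /andP[uy uq].
  by rewrite [used J y]/used (meet_J uy dx) -/(used I y) uy IH.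
- exact: IH.
Qed.

(* As there are no shortcuts, [x] lies in the span of every base except the last
   one, so exchanging it with the point of [I] in [ball x'] preserves these spans. *)
Lemma augpath_peel :
  [/\ good J, augpath J (x' :: r), ~~ used J x', #|J| = #|I|
    & augment I [:: x, x' & r] = augment J (x' :: r)].
Proof.
have [[_ _ _] [nx ux ar]] := pI; have [iI cI uI] := gI.
have xx' := x_far ux'.
have uJ : J :&: ball x' = set0.
  apply/setP=> u; rewrite !inE; case: eqP => [->|_] /=; first by rewrite (negPf xx').
  by case: (u \in ball x'); rewrite ?andbF.
have I0 : I :&: ball x = set0 by move: fx; rewrite negbK => /eqP.
split=> //.
- split=> // [u|u v]; rewrite !inE.
    by move=> /orP[/eqP->//|/andP[_ /cI]].
  have nx0 u' : u' \in I -> u' \in ball x -> False.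
    by move=> u1 u2; have := in_set0 u'; rewrite -I0 inE u1 u2.
  move=> /orP[/eqP->|/andP[_ u1]] /orP[/eqP->//|/andP[_ v1]] vu.
  - by case: (nx0 v).
  - by case: (nx0 u) => //; rewrite (ballP vu) cI.
  - exact: uI.
- exact: augpath_J.
- by rewrite negbK uJ.
rewrite /augment /=; congr foldl; apply/setP=> u; rewrite !inE.
case: (eqVneq u x') => [->|_]; rewrite ?orbT // !orbF.
case ub: (u \in ball x') => //=; case: (eqVneq u x) => [->|_]; rewrite ?orbT //= orbF.
case uI': (u \in I); rewrite ?andbF // andbT.
by have := in_set0 u; rewrite -I0 inE uI' => /= ->.
Qed.

End Peel.

(** Peeling the end leaves a shorter path for a set of the same size, whose new end again has a free
    block; the last remaining point, the source, is simply added. *)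
Lemma augmentP I x p : good I -> augpath I (x :: p) -> ~~ used I x ->
  good (augment I (x :: p)) /\ #|augment I (x :: p)| = #|I|.+1.
Proof.
elim: p I x => [|x' p IH] I x gI pI fx; last first.
  have [gJ pJ fJ cJ ->] := augpath_peel gI pI fx.
  by rewrite -cJ; exact: IH.
case: pI => -[xI xb ix] _; have [iI cI uI] := gI.
have I0 : I :&: ball x = set0 by move: fx; rewrite negbK => /eqP.
have nx0 u' : u' \in I -> u' \in ball x -> False.
  by move=> u1 u2; have := in_set0 u'; rewrite -I0 inE u1 u2.
have -> : augment I [:: x] = x |: I.
  rewrite /augment /= setUC; congr (_ |: _); apply/setP=> u; rewrite inE.
  case uI': (u \in I); rewrite ?andbF // andbT.
  by apply/negP => /(nx0 _ uI').
split; last by rewrite cardsU1 xI.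
split=> // [u|u v]; rewrite !inE.
  by move=> /orP[/eqP->//|/cI].
move=> /orP[/eqP->|u1] /orP[/eqP->//|v1] vu.
- by case: (nx0 v).
- by case: (nx0 u) => //; rewrite (ballP vu) cI.
- exact: uI.
Qed.

Definition estep A p (st : seq (T * seq T) * {set T}) z :=
  if z \in ball z then
    if z \in st.2 then st
    else if ind (A :|: [set z]) then ((z, p) :: st.1, st.2 :|: [set z]) else st
  else st.

Definition expand A p st := foldl (estep A p) st (enum T).

(** The cardinality clause pays for each new worklist entry with a newly visited point, which yields
    termination in [searchP]. *)
Lemma expandP A p w v : exists new : seq T,
  let st := expand A p (w, v) in
  [/\ st.1 = [seq (z, p) | z <- new] ++ w, st.2 = v :|: [set z in new],
      #|st.2| = #|v| + size new,
      forall z, z \in new -> [/\ z \in ball z, z \notin v & ind (z |: A)]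
    & forall z, z \in ball z -> ind (z |: A) -> z \in st.2].
Proof.
suff H s : exists new : seq T,
  let st := foldl (estep A p) (w, v) s in
  [/\ st.1 = [seq (z, p) | z <- new] ++ w, st.2 = v :|: [set z in new],
      #|st.2| = #|v| + size new,
      forall z, z \in new -> [/\ z \in ball z, z \notin v & ind (z |: A)]
    & forall z, z \in s -> z \in ball z -> ind (z |: A) -> z \in st.2].
  have [new [H1 H2 H3 H4 H5]] := H (enum T); exists new; split=> // z.
  by apply: H5; rewrite mem_enum.
elim/last_ind: s => [|s x [new]].
  exists [::]; split=> //; rewrite ?addn0 //=.
  by apply/setP=> z; rewrite !inE orbF.
rewrite -cats1 foldl_cat /=; set st := foldl _ _ _ => -[H1 H2 H3 H4 H5].
have keep : (x \in ball x -> ind (x |: A) -> x \in st.2) ->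
    forall z, z \in s ++ [:: x] -> z \in ball z -> ind (z |: A) -> z \in st.2.
  by move=> Hx z; rewrite mem_cat inE => /orP[/H5//|/eqP->].
rewrite /estep; case: ifP => [xb|xb]; last by exists new; split=> //; apply: keep; rewrite xb.
case: ifP => [xv|xv]; first by exists new; split=> //; apply: keep.
rewrite setUC; case: ifP => [xi|xi]; last by exists new; split=> //; apply: keep; rewrite xi.
exists (x :: new); split=> /=.
- by rewrite H1.
- by rewrite H2; apply/setP=> z; rewrite !inE; case: (z \in v); rewrite ?orbT //= orbC.
- by rewrite setUC cardsU1 xv H3; lia.
- move=> z; rewrite inE => /orP[/eqP->|/H4//]; split=> //.
  by apply: contraFN xv => xv; rewrite H2 inE xv.
- move=> z; rewrite mem_cat !inE => /orP[zs zb zi|/eqP->]; last by rewrite eqxx orbT.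
  by rewrite H5.
Qed.

(* The worklist needs no particular order: a point is expanded completely before
   its descendants are labelled, which already excludes shortcuts. *)
Definition search_step I (s : seq (T * seq T) * {set T} * seq T) :=
  if s.2 is _ :: _ then s
  else if s.1.1 is (x, q) :: w then
    if used I x then (expand (I :\: ball x) (x :: q) (w, s.1.2), [::])
    else (s.1, x :: q)
  else s.

Definition search I : seq T :=
  (foldl (fun s (_ : T) => search_step I s) (expand I [::] ([::], I), [::]) (enum T)).2.

Definition closed_in I (v : {set T}) x : Prop :=
  used I x /\ forall z, z \in ball z -> ind (z |: (I :\: ball x)) -> z \in v.

(** The certificate left by a failed search: [v] is closed under the arcs of the exchange graph, and
    its points outside [I] all have blocks occupied by [I]. *)
Definition stuck I (v : {set T}) : Prop :=
  [/\ I \subset v, forall x, x \in v -> x \in ball x,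
      forall z, z \in ball z -> ind (z |: I) -> z \in v
    & forall x, x \in v -> x \in I \/ closed_in I v x].

Lemma closed_in_sub I (v v' : {set T}) x : v \subset v' -> closed_in I v x -> closed_in I v' x.
Proof. by move=> /subsetP vv' [ux cx]; split=> // z zb zi; apply: vv'; exact: cx. Qed.

Definition found I p : Prop :=
  if p is x :: _ then [/\ augpath I p, ~~ used I x & uniq p] else True.

Lemma no_shortcutP I (v : {set T}) z q : 
  (forall x, x \in q -> closed_in I v x) ->
  (forall x, x \in ball x -> ind (x |: I) -> x \in v) ->
  z \in ball z -> z \notin v -> no_shortcut I z q.
Proof.
move=> cq cI zb zv; elim: q cq => //= y q IH cq; split.
  apply: contra zv; case: q cq {IH} => [|y' q] cq /=; first exact: cI.
  by case: (cq y') => [|_]; rewrite ?inE ?eqxx ?orbT //; apply.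
by apply: IH => x xq; apply: cq; rewrite inE xq orbT.
Qed.

Lemma searchP I : good I ->
  found I (search I) /\ (search I = [::] -> exists v, stuck I v).
Proof.
move=> gI; have [iI cI uI] := gI.
pose path_ok (v : {set T}) x q := [/\ augpath I (x :: q), {subset x :: q <= v},
  uniq (x :: q) & forall y, y \in q -> closed_in I v y].
pose inv k (s : seq (T * seq T) * {set T} * seq T) :=
  if s.2 is _ :: _ then found I s.2 else let w := s.1.1 in let v := s.1.2 in
  [/\ I \subset v, forall x, x \in v -> x \in ball x,
      forall z, z \in ball z -> ind (z |: I) -> z \in v
    & forall x q, (x, q) \in w -> path_ok v x q] /\
  [/\ forall x, x \in v -> [\/ x \in I, closed_in I v x | exists q, (x, q) \in w]
    & w = [::] \/ size w + k <= #|v|].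
have H s : inv (size s) (foldl (fun s (_ : T) => search_step I s)
    (expand I [::] ([::], I), [::]) s).
  elim/last_ind: s => [|s t].
    have [new] := expandP I [::] [::] I; rewrite /inv /=.
    move: (expand _ _ _) => [w v] /= [H1 H2 H3 H4 H5]; split; split=> //.
    - by rewrite H2 subsetUl.
    - by move=> x; rewrite H2 !inE => /orP[/cI|/H4[]].
    - move=> x q; rewrite H1 cats0 => /mapP[z zn [-> ->]].
      have [zb zI zi] := H4 _ zn; split=> //.
      by move=> u; rewrite inE => /eqP->; rewrite H2 !inE zn orbT.
    - move=> x; rewrite {1}H2 !inE => /orP[xI|xn]; first by constructor 1.
      by constructor 3; exists [::]; rewrite H1 cats0; apply/mapP; exists x.
    - by right; rewrite addn0 H1 cats0 size_map H3 leq_addl.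
  rewrite -cats1 foldl_cat size_cat addn1 /=; move: (foldl _ _ _) => [[w v] [|y p]] //.
  rewrite /inv /= => -[[H1 H2 H3 H4] [H5 H6]]; rewrite /search_step /=.
  case: w H4 H5 H6 => [|[x q] w] H4 H5 H6 /=; first by split; split=> //; left.
  have [ap sv un cl] := H4 x q (mem_head _ _).
  case: ifP => [ux|/negbT ux]; last by split.
  have [new] := expandP (I :\: ball x) (x :: q) w v.
  move: (expand _ _ _) => [w1 v1] /= [E1 E2 E3 E4 E5].
  have vv1 : v \subset v1 by rewrite E2 subsetUl.
  have clx : closed_in I v1 x by [].
  have clq y : y \in x :: q -> closed_in I v1 y.
    by rewrite inE => /orP[/eqP->//|/cl]; exact: closed_in_sub.
  have uxq : all (used I) (x :: q) by apply/allP => y /clq[].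
  split; split.
  - exact: subset_trans vv1.
  - by move=> z; rewrite E2 !inE => /orP[/H2//|/E4[]].
  - by move=> z zb zi; apply: (subsetP vv1); exact: H3.
  - move=> z qz; rewrite E1 mem_cat => /orP[/mapP[u un' [-> ->]]|zw].
      have [ub uv ui] := E4 _ un'; split=> //.
      + split; split=> //.
          by apply: contra uv => /(subsetP H1).
        split; last exact: (no_shortcutP cl).
        case: (q) cl => [|y q'] cl' /=; first by apply: contra uv; exact: H3.
        by case: (cl' y (mem_head _ _)) => _ cy; apply: contra uv; exact: cy.
      + move=> y; rewrite inE => /orP[/eqP->|/sv/(subsetP vv1)//].
        by rewrite E2 !inE un' orbT.
      + by rewrite cons_uniq un andbT; apply: contra uv => /sv.
    have [|a1 a2 a3 a4] := H4 z qz; first by rewrite inE zw orbT.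
    split=> //.
      by move=> y /a2/(subsetP vv1).
    by move=> y /a4; exact: closed_in_sub.
  - move=> z; rewrite {1}E2 !inE => /orP[zv|zn]; last first.
      by constructor 3; exists (x :: q); rewrite E1 mem_cat map_f.
    have [zI|zc|[qz]] := H5 z zv; first by constructor 1.
      by constructor 2; exact: closed_in_sub zc.
    rewrite inE => /orP[/eqP[-> _]|zw]; first by constructor 2.
    by constructor 3; exists qz; rewrite E1 mem_cat zw orbT.
  - right; case: H6 => // H6; rewrite E1 size_cat size_map E3; move: H6 => /=; lia.
have := H (enum T); rewrite /search; move: (foldl _ _ _) => [[w v] [|y p]] //.
rewrite /inv /= -cardE => -[[H1 H2 H3 H4] [H5 H6]]; split=> // _.
(* Each step pops one entry, so [size w + #|T| <= #|v|] after [#|T|] steps, which leaves no pending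
   work. *)
have w0 : w = [::].
  case: H6 => // H6; apply/nilP; rewrite /nilp.
  by rewrite -leqn0 -(leq_add2r #|T|) add0n; exact: leq_trans H6 (max_card _).
exists v; split=> // x /H5[]; [by left | by right | by rewrite w0 => -[]].
Qed.

(** Discard the blocks that hold a visited point outside [I]. What is left of [I] is smaller than
    what is left of [S], which also meets the empty block [b0]. Exchange gives an unvisited [t]
    extending the rest of [I]; as [t |: I] is dependent, [t] can replace some discarded [y], and the
    visited point in the block of [y] would have labelled [t]. *)
Lemma stuckP (bs : seq {set T}) I (v S : {set T}) b0 :
  (forall x, x \in ball x -> ball x \in bs) ->
  (forall b x, b \in bs -> x \in b -> ball x = b) ->
  good I -> stuck I v -> b0 \in bs -> I :&: b0 = set0 ->
  ind S -> hits S bs -> False.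
Proof.
move=> bbs bsb [iI cI uI] [Iv vb cv clv] b0s I0 iS hS.
have nI0 u : u \in I -> u \in b0 -> False.
  by move=> u1 u2; have := in_set0 u; rewrite -I0 inE u1 u2.
pose bad u := [exists x, [&& x \in v, x \notin I & u \in ball x]].
pose A := [set u in I | ~~ bad u].
pose B := [set u in S | (u \in ball u) && ~~ bad u].
have badb u u' : ball u = ball u' -> u \in ball u -> u' \in ball u' -> bad u -> bad u'.
  move=> e bu bu' /existsP[x /and3P[xv xI ux]]; apply/existsP; exists x.
  by rewrite xv xI /= -(ballP ux) e.
have /set0Pn[t0] := hS _ b0s; rewrite inE => /andP[t0S t0b].
have t0e := bsb _ _ b0s t0b.
pose phi a := odflt t0 [pick t in S :&: ball a].
have phiP a : a \in A -> phi a \in S :&: ball a.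
  rewrite inE => /andP[/cI/bbs/hS/set0Pn[t ta] _]; rewrite /phi; case: pickP => //= n.
  by have := n t; rewrite ta.
have AB : #|A| < #|B|.
  have inj : {in A &, injective phi}.
    move=> a a' aA a'A e; have := phiP _ aA; have := phiP _ a'A; rewrite -e !inE.
    move=> /andP[_ p'] /andP[_ p]; move: aA a'A; rewrite !inE => /andP[aI _] /andP[a'I _].
    by apply: uI => //; rewrite (ball_eq p' p) cI.
  rewrite -(card_in_imset inj); apply: proper_card; apply/properP; split.
    apply/subsetP => _ /imsetP[a aA ->]; have := phiP _ aA; rewrite !inE.
    move=> /andP[-> pb] /=; rewrite (ballP pb) pb /=.
    move: aA; rewrite inE => /andP[aI]; apply: contra; apply: badb.
    - exact: ballP.
    - by rewrite (ballP pb).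
    - exact: cI.
  (* A visited point outside [I] in the block of [t0] would be closed, hence its block occupied, but
     [I] misses [b0]. For the same reason [t0] is not in the image of [phi]. *)
  exists t0.
    rewrite inE t0S t0e t0b /=; apply/negP => /existsP[x /and3P[xv xI tx]].
    have [xI'|[/set0Pn[u]]] := clv _ xv; first by rewrite xI' in xI.
    by rewrite inE -(ballP tx) t0e => /andP[uI' ub]; case: (nI0 u).
  apply/imsetP => -[a aA ta]; have := phiP _ aA; rewrite -ta inE => /andP[_ tb].
  move: aA; rewrite inE => /andP[aI _]; apply: (nI0 a) => //.
  by rewrite -t0e (ballP tb) cI.
have iA : ind A by apply: indep_sub iI; apply/subsetP => u; rewrite inE => /andP[].
have iB : ind B by apply: indep_sub iS; apply/subsetP => u; rewrite inE => /andP[].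
have [t] := indep_exchange iA iB AB; rewrite inE => /andP[tA].
rewrite inE => /and3P[tS tb tbad] itA.
have tI : t \notin I by apply: contra tA => tI; rewrite inE tI.
have tv : t \notin v.
  by apply: contra tbad => tv; apply/existsP; exists t; rewrite tv tI tb.
(* Grown back inside [t |: I] to the size of [I], the set omits exactly one [y] of [I]; it lies in a
   discarded block because all of [A] was kept. *)
have [A' [s1 s2 iA' c]] := indep_extend itA iI.
have sA' : A' \subset t |: I.
  apply: subset_trans s2 _; rewrite !subUset sub1set !inE eqxx subsetUr /= andbT.
  by apply/subsetP => u; rewrite !inE => /andP[-> _]; rewrite orbT.
have dI : ~~ ind (t |: I) by apply: contra tv; exact: cv.
have [y yI yA'] : exists2 y, y \in I & y \notin A'.
  apply/subsetPn; apply: contra dI => IA'.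
  suff <- : A' = t |: I by [].
  apply/eqP; rewrite eqEsubset sA' subUset IA' sub1set andbT /=.
  by apply: (subsetP s1); rewrite !inE eqxx.
have : bad y.
  apply: contraR yA' => nb; apply: (subsetP s1); by rewrite !inE yI nb orbT.
move=> /existsP[x /and3P[xv xI yx]].
have [xI'|[ux cx]] := clv _ xv; first by rewrite xI' in xI.
move: tv; rewrite cx //.
apply: (indep_sub _ iA').
suff -> : A' = t |: (I :\ y).
  by apply: setUS; apply: setDS; rewrite sub1set.
apply/eqP; rewrite eqEcard; apply/andP; split.
  apply/subsetP => u uA'; have := subsetP sA' _ uA'; rewrite !inE.
  by case: eqP => //= _ ->; rewrite andbT; apply: contraTneq uA' => ->.
apply: leq_trans c; rewrite cardsU1 !inE (negPf tI) andbF add1n.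
by rewrite [in leqRHS](cardsD1 y) yI add1n.
Qed.

End Augmentation.

(** * Matroid constraints *)

(* An element is a pair: its singleton and the ball that contains it. *)

(* (base, (path, (elements, (work, visited)))) -> (work, visited) *)
Definition FExpand : fn :=
  let acc := FFst FArg in let z := FFst (FSnd FArg) in
  let base := FFst (FSnd (FSnd FArg)) in let path := FSnd (FSnd (FSnd FArg)) in
  FFold
    (FIf (FComp FMeets (FPair (FFst z) (FSnd z)))
      (FIf (FComp FMeets (FPair (FFst z) (FSnd acc))) acc
        (FIf (FAsk (FComp FOr (FPair base (FFst z))))
          (FPair (FPair (FPair z path) (FFst acc))
                 (FComp FOr (FPair (FSnd acc) (FFst z))))
          acc))
      acc)
    (FFst (FSnd (FSnd FArg))) (FSnd (FSnd (FSnd FArg)))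
    (FPair (FFst FArg) (FFst (FSnd FArg))).

(* (((work, visited), result), (_, (I, elements))) -> ((work, visited), result) *)
Definition FSearchStep : fn :=
  let acc := FFst FArg in let I := FFst (FSnd (FSnd FArg)) in
  let elements := FSnd (FSnd (FSnd FArg)) in
  let work := FFst (FFst acc) in let p := FFst work in let b := FSnd (FFst p) in
  FIf (FSnd acc) acc
    (FIf work
      (FIf (FComp FMeets (FPair I b))
        (FPair (FComp FExpand (FPair (FComp FDiff (FPair I b)) (FPair p
                 (FPair elements (FPair (FSnd work) (FSnd (FFst acc))))))) FNil)
        (FPair (FFst acc) p))
      acc).

(* (I, elements) -> path *)
Definition FSearch : fn :=
  FSnd (FFold FSearchStep (FSnd FArg)
    (FPair (FComp FExpand (FPair (FFst FArg) (FPair FNil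
              (FPair (FSnd FArg) (FPair FNil (FFst FArg)))))) FNil)
    FArg).

(* (I, elements) -> I *)
Definition FAugment : fn :=
  FFold (FComp FOr (FPair (FComp FDiff (FPair (FFst FArg) (FSnd (FFst (FSnd FArg)))))
                          (FFst (FFst (FSnd FArg)))))
    FSearch (FFst FArg) FNil.

(* (I, balls) -> (I, nil) *)
Definition FMEnd : fn :=
  FIf (FFold (FIf (FFst FArg)
                (FComp FMeets (FPair (FSnd (FSnd FArg)) (FFst (FSnd FArg)))) FNil)
         (FSnd FArg) FTrue (FFst FArg))
    (FPair (FFst FArg) FNil) FNil.

(* (elements, balls) -> (I, nil) *)
Definition FTransversal : fn :=
  FComp FMEnd
    (FPair (FFold (FComp FAugment (FPair (FFst FArg) (FSnd (FSnd FArg))))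
              (FFst FArg) (FComp (FMap FNil) (FPair (FFst FArg) FNil)) (FFst FArg))
           (FSnd FArg)).

(* (singleton, balls) -> element *)
Definition FElement : fn :=
  FPair (FFst FArg)
    (FFold (FIf (FComp FMeets (FPair (FSnd (FSnd FArg)) (FFst (FSnd FArg))))
              (FFst (FSnd FArg)) (FFst FArg))
       (FSnd FArg) (FComp FDiff (FPair (FFst FArg) (FFst FArg))) (FFst FArg)).

(* (balls, singletons) -> (I, nil) *)
Definition FMatroid : fn :=
  FComp FTransversal
    (FPair (FComp (FMap FElement) (FPair (FSnd FArg) (FFst FArg))) (FFst FArg)).

Section MatroidSelect.
Variables (R : realFieldType) (orc : val R -> bool) (N : nat).
Local Notation ev := (feval orc N).
Variables (T : finType) (M : matroid T).
Hypothesis TN : (#|T| <= N)%N.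
Hypothesis orcP : forall A : {set T}, orc (mask R A) = (A \in indep M).

Lemma meets1 (z : T) (A : {set T}) : ([set z] :&: A != set0) = (z \in A).
Proof. by rewrite setI_eq0 disjoints1 negbK. Qed.

Section Round.
Variable ball : T -> {set T}.

Definition elt (z : T) : val R := VPair (mask R [set z]) (mask R (ball z)).
Definition enc_path (p : seq T) : val R := vlist [seq elt z | z <- p].
Definition enc_work (w : seq (T * seq T)) : val R :=
  vlist [seq enc_path (xq.1 :: xq.2) | xq <- w].
Definition enc_wv (s : seq (T * seq T) * {set T}) : val R :=
  VPair (enc_work s.1) (mask R s.2).
Definition enc_search (s : seq (T * seq T) * {set T} * seq T) : val R :=
  VPair (enc_wv s.1) (enc_path s.2).

Lemma ev_expand A p s :
  ev FExpand (VPair (mask R A) (VPair (enc_path p) (VPair (tab elt) (enc_wv s)))) =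
  enc_wv (expand M ball A p s).
Proof.
rewrite /= take_spine_tab // foldl_map /expand.
rewrite -/(enc_wv s) (foldl_morph (enc := enc_wv) (G := estep M ball A p)) //.
move=> {}s z; rewrite /= !ev_meets // !meets1 !truthy_vbool ev_or // orcP.
by rewrite ev_or // /estep; do 3!case: ifP => // _.
Qed.

Lemma ev_search_step I s x :
  ev FSearchStep (VPair (enc_search s) (VPair x (VPair (mask R I) (tab elt)))) =
  enc_search (search_step M ball I s).
Proof.
Opaque FExpand.
case: s => [[w v] [|y p]] //; case: w => [|[y q] w] //=.
rewrite ev_meets // truthy_vbool ev_diff //.
rewrite -[VPair (vlist _) (mask R v)]/(enc_wv (w, v)) ev_expand.
by rewrite /search_step /= /used; case: ifP.
Qed.

Lemma ev_search I : ev FSearch (VPair (mask R I) (tab elt)) = enc_path (search M ball I).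
Proof.
Opaque FSearchStep.
rewrite /= take_spine_tab // foldl_map.
rewrite -[VPair VNil (mask R I)]/(enc_wv ([::], I)) -{1}[VNil]/(enc_path [::]) ev_expand.
rewrite -[VPair (enc_wv _) VNil]/(enc_search (expand M ball I [::] ([::], I), [::])).
rewrite (foldl_morph (enc := enc_search) (G := fun s _ => search_step M ball I s)) //.
by move=> s z; exact: ev_search_step.
Qed.

Lemma ev_augment I : (size (search M ball I) <= N)%N ->
  ev FAugment (VPair (mask R I) (tab elt)) = mask R (augment ball I (search M ball I)).
Proof.
Opaque FSearch.
move=> sN; rewrite /= ev_search take_spine ?size_map // foldl_map.
rewrite (foldl_morph (enc := @mask R T)
  (G := fun J x => (J :\: ball x) :|: [set x])) // => J x.
by rewrite /= ev_diff // ev_or.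
Qed.

End Round.

(** With disjoint blocks at most one contains [z]. The default [set0] is built in the program as the
    difference of a mask with itself, which gives it the right length. *)
Definition ball_of (bs : seq {set T}) (z : T) : {set T} :=
  foldl (fun acc (b : {set T}) => if z \in b then b else acc) set0 bs.

Lemma ev_element bs z : (size bs <= N)%N ->
  ev FElement (VPair (mask R [set z]) (vlist [seq mask R b | b <- bs])) =
  elt (ball_of bs) z.
Proof.
move=> sN; rewrite /= take_spine ?size_map // foldl_map ev_diff // setDv; congr VPair.
rewrite (foldl_morph (enc := @mask R T)
  (G := fun acc (b : {set T}) => if z \in b then b else acc)) // => A b /=.
by rewrite ev_meets // meets1 truthy_vbool; case: ifP.
Qed.

Lemma ball_ofP bs z :
  z \in ball_of bs z /\ ball_of bs z \in bs \/
  ball_of bs z = set0 /\ forall b, b \in bs -> z \notin b.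
Proof.
rewrite /ball_of; elim/last_ind: bs => [|bs b IH]; first by right.
rewrite -cats1 foldl_cat /=; case: ifP => [zb|/negbT zb].
  by left; rewrite mem_cat mem_head orbT.
case: IH => [[z1 z2]|[-> z2]]; first by left; rewrite mem_cat z2.
by right; split=> // b'; rewrite mem_cat inE => /orP[/z2//|/eqP->].
Qed.

Lemma pairwise_disjoint_eq (bs : seq {set T}) b b' z :
  pairwise (fun A B : {set T} => [disjoint A & B]) bs ->
  b \in bs -> b' \in bs -> z \in b -> z \in b' -> b = b'.
Proof.
elim: bs => //= a bs IH /andP[/allP da dbs]; rewrite !inE.
move=> /orP[/eqP->|bb] /orP[/eqP->|bb'] zb zb' //; last exact: IH.
  by have := da _ bb'; rewrite disjoint_sym => /disjointFl/(_ zb); rewrite zb'.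
by have := da _ bb; rewrite disjoint_sym => /disjointFl/(_ zb'); rewrite zb.
Qed.

Lemma matroidP bs : (size bs <= N)%N ->
  pairwise (fun A B : {set T} => [disjoint A & B]) bs ->
  selects (fun S : {set T} => S \in indep M) bs
    (ev FMatroid (VPair (vlist [seq mask R b | b <- bs])
                        (tab (fun z : T => mask R [set z])))).
Proof.
move=> sN disj; set ball := ball_of bs.
have ballbs x : x \in ball x -> ball x \in bs.
  by rewrite /ball; case: (ball_ofP bs x) => [[]//|[-> _]]; rewrite inE.
have ballE b x : b \in bs -> x \in b -> ball x = b.
  move=> bb xb; rewrite /ball; case: (ball_ofP bs x) => [[xx xbs]|[_ /(_ _ bb)]].
    exact: pairwise_disjoint_eq disj xbs bb xx xb.
  by rewrite xb.
have ballP x y : y \in ball x -> ball y = ball x.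
  move=> yx; apply: ballE (yx); move: yx; rewrite /ball.
  by case: (ball_ofP bs x) => [[]//|[-> _]]; rewrite inE.
pose round I := augment ball I (search M ball I).
have round_good I : good M ball I -> (size (search M ball I) <= N)%N /\ good M ball (round I).
  move=> gI; have [] := searchP gI; rewrite /round; case: search => [|x p] //.
  move=> [ap fx un] _; split; last by have [] := augmentP ballP gI ap fx.
  (* The points of a path are distinct, so the fuel does not truncate the augmentation. *)
  apply: leq_trans TN; rewrite -(card_uniqP un); exact: max_card.
have good0 : good M ball set0 by split=> [|x|x y]; rewrite ?indep0 ?inE.
have rounds_good s : good M ball (foldl (fun I (_ : T) => round I) set0 s).
  by elim/last_ind: s => // s x IH; rewrite -cats1 foldl_cat; case: (round_good _ IH).
pose final := foldl (fun I (_ : T) => round I) set0 (enum T).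
have -> : ev FMatroid (VPair (vlist [seq mask R b | b <- bs])
                        (tab (fun z : T => mask R [set z]))) =
          ev FMEnd (VPair (mask R final) (vlist [seq mask R b | b <- bs])).
  Opaque FElement FAugment FMEnd.
  rewrite /= ev_map_tab // (eq_tab (fun z => ev_element z sN)) -/ball.
  congr (ev FMEnd (VPair _ _)); rewrite take_spine_tab // foldl_map ev_map_tab //= mask_set0.
  rewrite /final; elim/last_ind: (enum T) => // s x IH.
  by rewrite -cats1 !foldl_cat /= IH ev_augment //; case: (round_good _ (rounds_good s)).
have [ifin _ _] := rounds_good (enum T); rewrite -/final in ifin.
have -> : ev FMEnd (VPair (mask R final) (vlist [seq mask R b | b <- bs])) =
   if all (fun b => final :&: b != set0) bs then VPair (mask R final) VNil else VNil.
  Transparent FMEnd.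
  rewrite /= take_spine ?size_map // foldl_map -[VPair VNil VNil]/(vbool R true).
  rewrite (foldl_morph (enc := vbool R) (G := fun a b => a && (final :&: b != set0))).
    rewrite truthy_vbool; congr (if _ then _ else _).
    have -> a : foldl (fun a b => a && (final :&: b != set0)) a bs =
      a && all (fun b => final :&: b != set0) bs; last by [].
    by elim: (bs) a => [|b s IH] a /=; rewrite ?andbT // IH andbA.
  by move=> a b; rewrite /= truthy_vbool ev_meets //; case: a.
case: ifP => [/allP hit|nhit]; [left|right]; first by exists final.
split=> // S iS hS.
(* While some ball is missed, [stuckP] against [S] rules out a failed search, and the round adds a
   point. Once all are met, no path can end in a free ball. *)
have grow s : let I := foldl (fun I (_ : T) => round I) set0 s in
  hits I bs \/ (size s <= #|I|)%N.
  elim/last_ind: s => [|s x IH]; first by right.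
  move: IH; rewrite -cats1 foldl_cat size_cat addn1 /=.
  have gI := rounds_good s; move: gI; set I := foldl _ _ _ => gI.
  have [] := searchP gI; rewrite /round; case: search => [_ /(_ erefl)[v stk]|x' p].
    case hI : (all (fun b => I :&: b != set0) bs) => _.
      by left=> b bb; move/allP: hI => /(_ _ bb).
    move/negbT: hI => /allPn[b bb]; rewrite negbK => /eqP I0.
    by case: (stuckP ballP ballbs ballE gI stk bb I0 iS hS).
  move=> [ap fx _] _ [hI|sI].
    case: ap => -[_ xb _] _; case: (negP fx).
    exact: hI (ballbs _ xb).
  have [[xb]] := ap; right.
  by have [_ ->] := augmentP ballP gI ap fx.
case: (grow (enum T)) => [h|]; rewrite -/final.
  by move/negP: nhit; apply; apply/allP.
(* Growth in every round makes [final] the whole ground set, which meets each ball because [S] shows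
   it nonempty. *)
rewrite -cardE => cT; move/negP: nhit; apply; apply/allP => b bb.
have -> : final = setT by apply/eqP; rewrite eqEcard subsetT cardsT.
by apply: contraNneq (hS _ bb) => b0; rewrite -(setTI b) b0 setI0.
Qed.

End MatroidSelect.

(** * The three problems *)

Opaque FSolve FKnap FMatroid.

(** Values are computed over an arbitrary [realFieldType], so one correctness proof serves both cost
    models; these differ only in the witness of [tame]. *)
Lemma has_polytime_approx_fn (P : forall R : realFieldType, problem R) rho (f : fn) :
  (forall (R : realFieldType) (I : instance (P R)),
     is_approx rho (set_of (ground I) (feval (@oracle R _ I) (fuel (encode I)) f (encode I)))) ->
  has_polytime_approx P rho.
Proof.
move=> fP; have [c cP] := program_polytime f; exists (program f), c; split.
  move=> R I; have [st [t [e b q]]] := cP R _ (@oracle _ _ I) (encode I) (@tame_unit_size R).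
  by exists st, t; split=> //; rewrite q; exact: fP.
move=> I; have [st [t [e b q]]] := cP rat _ (@oracle _ _ I) (encode I) tame_bit_size.
by exists st, t; split=> //; rewrite q; exact: fP.
Qed.

(** * From covering to the objective value *)

Section Objective.
Variables (R : realFieldType) (V T : finType) (dT : V -> T -> R) (r : V -> R).
Hypothesis dT_ge0 : forall v f, 0 <= dT v f.
Hypothesis r_gt0 : forall v, 0 < r v.
Implicit Type S : {set T}.

Lemma dist_to_fin v S f : f \in S ->
  exists2 g, g \in S & dist_to dT v S = (dT v g)%:E.
Proof.
move=> fS; have [|g gS e] := @eq_bigmin _ _ _ (+oo%E) f (mem S) (fun s => (dT v s)%:E) fS.
  by move=> g _; exact: leey.
by exists g.
Qed.

Lemma dist_to_ge0 v S : (0 <= dist_to dT v S)%E.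
Proof. by apply: le_bigmin => [|f _]; rewrite ?leey ?lee_fin. Qed.

Lemma div_radius x v : (x%:E / (r v)%:E = (x / r v)%:E)%E.
Proof. by rewrite inver gt_eqF. Qed.

Lemma priority_radius_le S (a : R) : 0 <= a ->
  (forall u, exists2 f, f \in S & dT u f <= a * r u) ->
  (priority_radius dT r S <= a%:E)%E.
Proof.
move=> a0 cov; apply: bigmax_le; first by rewrite lee_fin.
move=> u _; have [f fS ua] := cov u; have [g gS e] := dist_to_fin u fS.
have gf : (dT u g <= dT u f)%R.
  by rewrite -lee_fin -e; apply: bigmin_le_cond.
by rewrite e div_radius lee_fin ler_pdivrMr //; exact: le_trans gf ua.
Qed.

(** A maximum of minima over finite types is attained at a pair, which is why guessing among the
    quotients suffices. The client [v] excludes the empty maximum. *)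
Lemma priority_radius_fin S (v : V) : S = set0 /\ priority_radius dT r S = +oo%E \/
  exists v0 f0, priority_radius dT r S = (dT v0 f0 / r v0)%:E /\
    covered dT r S (dT v0 f0) (r v0).
Proof.
case: (set_0Vmem S) => [->|[f fS]]; [left|right].
  split=> //; apply/eqP; rewrite -leye_eq.
  have <- : (dist_to dT v set0 / (r v)%:E = +oo)%E.
    by rewrite /dist_to big_set0 inver gt_eqF // gt0_mulye // lte_fin invr_gt0.
  exact: le_bigmax.
have [|v0 _ e] := @eq_bigmax _ _ _ 0%E v xpredT
   (fun v => dist_to dT v S / (r v)%:E)%E isT.
  by move=> u _; rewrite mule_ge0 ?dist_to_ge0 // inve_ge0 lee_fin ltW.
have [f0 _ e0] := dist_to_fin v0 fS.
have eR : priority_radius dT r S = (dT v0 f0 / r v0)%:E.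
  by rewrite /priority_radius e e0 div_radius.
exists v0, f0; split=> // u; have [g gS eg] := dist_to_fin u fS; exists g => //.
have : (dist_to dT u S / (r u)%:E <= priority_radius dT r S)%E by exact: le_bigmax.
by rewrite eR eg div_radius lee_fin ler_pdivrMr // mulrAC ler_pdivlMr.
Qed.

(** Feasibility of [S] makes the optimum attained by some [S']. Without clients the left side is 0,
    an infinite optimum bounds everything, and otherwise the optimum is one of the guesses. *)
Lemma covered_approx (feas : {set T} -> bool) S : feas S ->
  (forall v f, (exists2 S', feas S' & covered dT r S' (dT v f) (r v)) ->
     covered dT r S (3 * dT v f) (r v)) ->
  (priority_radius dT r S <=
   3%:R%:E * \big[Order.min/+oo]_(S' : {set T} | feas S') priority_radius dT r S')%E.
Proof.
move=> fS cov.
have [|S' fS' ->] := @eq_bigmin _ _ _ (+oo%E) S feas (priority_radius dT r) fS.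
  by move=> *; exact: leey.
have r_ge0 : (0 <= priority_radius dT r S')%E by exact: bigmax_ge_id.
case: (pickP (@predT V)) => [v _|V0]; last first.
  by rewrite {1}/priority_radius big_pred0 ?mule_ge0 ?lee_fin // => v; have := V0 v.
case: (priority_radius_fin S' v) => [[_ ->]|[v0 [f0 [-> cS']]]].
  by rewrite gt0_muley ?leey // lte_fin ltr0n.
rewrite -EFinM; apply: priority_radius_le.
  by rewrite mulr_ge0 // divr_ge0 ?dT_ge0 // ltW.
move=> u; have [|f fS1 uf] := cov v0 f0 _ u; first by exists S'.
exists f => //; rewrite -(ler_pM2r (r_gt0 v0)); apply: le_trans uf _.
rewrite [leRHS](_ : _ = 3 * dT v0 f0 * r u) //.
by field; rewrite gt_eqF.
Qed.

End Objective.

(** A metric vanishes only on the diagonal, so this test locates a point in its own row. The zero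
    compared with is an empty sum. *)
Definition FIsZero : fn := FSumLe (F1 (FFst FArg)) FOne FOne FNil.

(* row of distances -> singleton *)
Definition FSingleton : fn := FComp (FMap FIsZero) (FPair FArg FNil).

(* (r, matrix) -> clients *)
Definition FClients : fn :=
  FComp (FMap (FPair (FFst (FFst FArg)) (FPair (FSnd (FFst FArg)) (FSnd (FFst FArg)))))
        (FPair FZip FNil).

(* matrix -> singletons *)
Definition FSingletons : fn :=
  FComp (FMap (FComp FSingleton (FFst FArg))) (FPair FArg FNil).

Definition FKnapsackCenter : fn :=
  FComp (FSolve FKnap)
    (FPair (FComp FClients (FPair (FFst (FSnd FArg)) (FFst FArg)))
           (FPair (FComp FZip (FPair (FFst (FSnd (FSnd FArg)))
                                     (FComp FSingletons (FFst FArg))))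
                  (FSnd (FSnd (FSnd FArg))))).

Definition FMatroidCenter : fn :=
  FComp (FSolve FMatroid)
    (FPair (FComp FClients (FPair (FSnd FArg) (FFst FArg)))
           (FComp FSingletons (FFst FArg))).

(* (l, l') -> l' without its last items, as many as in l *)
Definition FFront : fn := FComp FRev (FComp FDrop (FPair (FFst FArg) (FComp FRev (FSnd FArg)))).

(* (facility rows, (matrix, (r, k))) -> solution *)
Definition FSupplierMain : fn :=
  let frows := FFst FArg in let r := FFst (FSnd (FSnd FArg)) in
  FComp (FSolve FKnap)
    (FPair
      (FComp (FMap (FPair (FFst (FFst FArg))
                     (FPair (FComp FFront (FPair (FFst (FSnd FArg)) (FSnd (FFst FArg))))
                            (FComp FDrop (FPair (FSnd (FSnd FArg)) (FSnd (FFst FArg)))))))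
             (FPair (FComp FZip (FPair r (FComp FDrop (FPair frows (FFst (FSnd FArg))))))
                    (FPair r frows)))
      (FPair
        (FComp (FMap (FPair FOne (FComp FSingleton
                                   (FComp FFront (FPair (FSnd FArg) (FFst FArg))))))
               (FPair frows r))
        (FSnd (FSnd (FSnd FArg))))).

Definition FSupplier : fn :=
  FComp FSupplierMain
    (FPair (FComp FFront (FPair (FFst (FSnd FArg)) (FFst FArg))) FArg).

Section FrontEnd.
Variables (R : realFieldType) (orc : val R -> bool) (N : nat).
Local Notation ev := (feval orc N).
Hypothesis N1 : (1 < N)%N.

Lemma ev_singleton (T : finType) (d : T -> R) x : (#|T| <= N)%N ->
  (forall y, (d y <= 0) = (y == x)) ->
  ev FSingleton (tab (fun y => VNum (d y))) = mask R [set x].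
Proof.
move=> TN dx; rewrite /= ev_map_tab //; apply: eq_tab => y /=.
by rewrite vsumle10 // mulr1 dx inE.
Qed.

Lemma metric_le0 (T : eqType) (d : T -> T -> R) x y : is_metric d -> (d x y <= 0) = (y == x).
Proof.
move=> [d0 di ds _]; rewrite eq_sym; apply/idP/eqP => [le0|->].
  by apply/di/eqP; rewrite eq_le le0 d0.
by rewrite (di y y).2.
Qed.

Section Center.
Variables (X : finType) (d : X -> X -> R) (r : X -> R).
Hypothesis XN : (#|X| <= N)%N.
Hypothesis dm : is_metric d.

Lemma enc_matrix_tab : enc_matrix (enum X) d = tab (fun x => tab (fun y => VNum (d x y))).
Proof. by rewrite /enc_matrix; congr vlist; apply: eq_map => x; rewrite vnums_tab. Qed.

Lemma ev_singletons :
  ev FSingletons (enc_matrix (enum X) d) = tab (fun x : X => mask R [set x]).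
Proof.
Opaque FSingleton.
rewrite enc_matrix_tab /= ev_map_tab //; apply: eq_tab => x /=.
by apply: ev_singleton => // y; exact: metric_le0.
Qed.

Lemma ev_clients :
  ev FClients (VPair (vnums [seq r x | x <- enum X]) (enc_matrix (enum X) d)) =
  tab (client d d r).
Proof. by rewrite enc_matrix_tab vnums_tab /= ev_zip_tab // ev_map_tab. Qed.

(** Shared by the knapsack and matroid problems, where each point is both client and facility and
    both distance tables are [d]. *)
Lemma center_approx sel extra (feas : {set X} -> bool) :
  (forall v, 0 < r v) -> feas set0 ->
  (forall bs : seq {set X}, (size bs <= N)%N ->
    pairwise (fun A B : {set X} => [disjoint A & B]) bs ->
    selects feas bs (ev sel (VPair (vlist [seq mask R b | b <- bs]) extra))) ->
  let S := set_of X (ev (FSolve sel) (VPair (tab (client d d r)) extra)) in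
  feas S /\ (priority_radius d r S <=
   3%:R%:E * \big[Order.min/+oo]_(S' : {set X} | feas S') priority_radius d r S')%E.
Proof.
move=> r0 f0 selP; have [d0 di ds dt] := dm.
have dtr u v f : d u v <= d u f + d v f by rewrite [d v f]ds.
have [] := @solveP R orc N X X d d r N1 XN XN d0 r0 (fun v => (di v v).2 erefl) ds
  dtr (fun u v f => dt u v f) sel extra feas selP f0.
by split=> //; exact: covered_approx.
Qed.

End Center.

Lemma ev_front (l a b : seq (val R)) : size l = size b -> (size (a ++ b) <= N)%N ->
  ev FFront (VPair (vlist l) (vlist (a ++ b))) = vlist a.
Proof.
move=> lb; rewrite size_cat => abN; rewrite /= ev_rev ?size_cat // ev_drop; last by lia.
rewrite rev_cat lb -(size_rev b) drop_size_cat // ev_rev ?revK // size_rev; lia.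
Qed.

End FrontEnd.

Lemma size_map_enum (T : finType) (A : Type) (f : T -> A) :
  size [seq f x | x <- enum T] = #|T|.
Proof. by rewrite size_map -cardE. Qed.

Opaque FFront FSingleton.

Section Supplier.
Variables (R : realFieldType) (orc : val R -> bool) (N : nat).
Local Notation ev := (feval orc N).
Variables (F C : finType) (d : F + C -> F + C -> R) (r : C -> R) (k : nat).
Hypothesis dm : is_metric d.
Hypothesis r_gt0 : forall v, 0 < r v.
Hypothesis NE : N = (#|F| + #|C|).+2.

Let dT (v : C) (f : F) := d (inr v) (inl f).
Let dV (v u : C) := d (inr v) (inr u).
Let s : seq (F + C) := [seq inl f | f <- enum F] ++ [seq inr v | v <- enum C].
Let row x := vnums [seq d x y | y <- s].
Let N1 : (1 < N)%N. Proof. by rewrite NE. Qed.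
Let FN : (#|F| <= N)%N. Proof. by rewrite NE; lia. Qed.
Let CN : (#|C| <= N)%N. Proof. by rewrite NE; lia. Qed.

(** The encoding does not state [#|F|] or [#|C|]. The list of radii counts the clients; removing
    that many final items isolates the facility part, which in turn counts what to drop to reach the
    client part. *)
Lemma ev_front_tab (f : F -> val R) (g h : C -> val R) :
  ev FFront (VPair (tab g)
    (vlist ([seq f x | x <- enum F] ++ [seq h x | x <- enum C]))) = tab f.
Proof. by rewrite ev_front // ?size_cat !size_map_enum // NE; lia. Qed.

Lemma ev_drop_tab (f g : F -> val R) (h : C -> val R) :
  ev FDrop (VPair (tab g)
    (vlist ([seq f x | x <- enum F] ++ [seq h x | x <- enum C]))) = tab h.
Proof. by rewrite ev_drop !size_map_enum // drop_size_cat // size_map_enum. Qed.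

Lemma row_cat x : row x = vlist ([seq VNum (d x (inl f)) | f <- enum F] ++
                                 [seq VNum (d x (inr v)) | v <- enum C]).
Proof. by rewrite /row /vnums /s !map_cat -!map_comp. Qed.

Lemma ev_supplier :
  ev FSupplier (VPair (enc_matrix s d) (VPair (vnums [seq r v | v <- enum C]) (VNum k%:R))) =
  ev (FSolve FKnap) (VPair (tab (client dT dV r))
    (VPair (tab (facility (fun _ : F => 1))) (VNum k%:R))).
Proof.
have -> : enc_matrix s d = vlist ([seq row (inl f) | f <- enum F] ++
                                  [seq row (inr v) | v <- enum C]).
  by rewrite /enc_matrix {2}/s map_cat -!map_comp.
rewrite vnums_tab /= ev_front_tab ev_drop_tab ev_zip_tab // !ev_map_tab //=.
rewrite (eq_tab (g := client dT dV r)); last first.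
  by move=> v; rewrite row_cat ev_front_tab ev_drop_tab.
rewrite (eq_tab (g := facility (fun _ : F => 1))) // => f.
rewrite row_cat ev_front_tab (@ev_singleton _ _ _ N1 _ _ f) // => y.
by rewrite (metric_le0 (inl f) (inl y) dm); apply/eqP/eqP => [[]|->].
Qed.

Lemma supplier_approx :
  let S := set_of F (ev FSupplier
    (VPair (enc_matrix s d) (VPair (vnums [seq r v | v <- enum C]) (VNum k%:R)))) in
  (#|S| <= k)%N /\ (priority_radius dT r S <= 3%:R%:E *
    \big[Order.min/+oo]_(S' : {set F} | (#|S'| <= k)%N) priority_radius dT r S')%E.
Proof.
rewrite ev_supplier; have [d0 di ds dt] := dm.
pose feas (S : {set F}) := \sum_(u in S) (1 : R) <= k%:R.
have feasE S : feas S = (#|S| <= k)%N by rewrite /feas sumr_const ler_nat.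
have f0 : feas set0 by rewrite feasE cards0.
have dVT u v f : dV u v <= dT u f + dT v f by rewrite /dT [d (inr v) _]ds; exact: dt.
have dT0 u f : 0 <= dT u f by exact: d0.
have dV0 u : dV u u = 0 by exact/di.
have dVs u v : dV u v = dV v u by exact: ds.
have dTV u v f : dT u f <= dV u v + dT v f by exact: dt.
have [S1 S2] := @solveP R orc N C F dT dV r N1 CN FN dT0 r_gt0 dV0 dVs dVT dTV
  FKnap (VPair (tab (facility (fun _ : F => 1))) (VNum k%:R)) feas
  (fun bs sN disj => knapP orc k%:R N1 FN (fun _ => ler01) sN disj) f0.
have := covered_approx dT0 r_gt0 S1 S2; rewrite (eq_bigl _ _ feasE).
by move: S1; rewrite feasE.
Qed.

End Supplier.

Lemma supplier_polytime : has_polytime_approx priority_k_supplier 3.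
Proof.
apply: (@has_polytime_approx_fn _ _ FSupplier) => R I.
apply: supplier_approx; [exact: sup_metric | exact: sup_r_gt0 |].
by rewrite /fuel /= /enc_matrix spine_vlist size_map size_cat !size_map_enum.
Qed.

Lemma knapsack_polytime : has_polytime_approx priority_knapsack_center 3.
Proof.
Opaque FSingletons FClients.
apply: (@has_polytime_approx_fn _ _ FKnapsackCenter) => R I.
set N := fuel _; set orc := @oracle _ _ I.
have NE : N = #|kna_X I|.+2.
  by rewrite /N /fuel /= /enc_matrix spine_vlist size_map -cardE.
have N1 : (1 < N)%N by rewrite NE.
have XN : (#|kna_X I| <= N)%N by rewrite NE; lia.
rewrite /= (@ev_clients _ orc N _ _ _ XN) (ev_singletons orc N1 XN (kna_metric I)).
rewrite vnums_tab ev_zip_tab //; apply: center_approx => //.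
- exact: kna_metric.
- exact: kna_r_gt0.
- by rewrite /= big_set0 ltW // kna_B_gt0.
- by move=> bs sN disj; apply: knapP => //; exact: kna_w_ge0.
Qed.

Lemma matroid_polytime : has_polytime_approx priority_matroid_center 3.
Proof.
Opaque FSingletons FClients.
apply: (@has_polytime_approx_fn _ _ FMatroidCenter) => R I.
set N := fuel _; set orc := @oracle _ _ I.
have NE : N = #|mat_X I|.+2.
  by rewrite /N /fuel /= /enc_matrix spine_vlist size_map -cardE.
have N1 : (1 < N)%N by rewrite NE.
have XN : (#|mat_X I| <= N)%N by rewrite NE; lia.
rewrite /= (@ev_clients _ orc N _ _ _ XN) (ev_singletons orc N1 XN (mat_metric I)).
apply: center_approx => //.
- exact: mat_metric.
- exact: mat_r_gt0.
- exact: indep0.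
- by move=> bs sN disj; apply: matroidP => // A; rewrite /orc /= set_of_mask.
Qed.

Theorem theorem2p5 :
  has_polytime_approx priority_k_supplier 3 /\
  has_polytime_approx priority_knapsack_center 3 /\
  has_polytime_approx priority_matroid_center 3.
Proof.
by split; [exact: supplier_polytime | split;
  [exact: knapsack_polytime | exact: matroid_polytime]].
Qed.
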